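(* Let $D\subseteq\mathbb{C}$ be a domain equipped with a metric $\rho$ with corresponding distance $d=d_\rho$, such that (1) $C_\rho:=\inf_{\zeta\in D}\rho(\zeta)>0$; (2) $d(\zeta,\eta)\to\infty$ as $\zeta\to\partial D$, for every $\eta\in D$. Let $\alpha\in(0,1]$ and $p\in[1,\infty)$. If an analytic mapping $f:\mathbb{D}\to D$ on the unit disk $\mathbb{D}$ satisfies $$m_p(r,f^\ast)=\mathcal{O}\big((1-r)^{\alpha-1}\big),\quad r\to1,$$ then $f\in\rho H^p$ and $f_b\in\rho\Lambda^p_\alpha$.
   Context: $\mathbb{D}$ is the open unit disk in $\mathbb{C}$. A metric $\rho$ on a domain $D\subseteq\mathbb{C}$ is a positive continuous function on $D$. The $\rho$-distance is $d_\rho(\zeta,\eta)=\inf_\gamma\int_\gamma\rho(\omega)\,|d\omega|$, the infimum being over all piecewise $\mathcal{C}^1$-smooth curves $\gamma$ in $D$ joining $\zeta$ and $\eta$. The boundary $\partial D$ is taken in the extended plane $\overline{\mathbb{C}}$. For an analytic mapping $f:\mathbb{D}\to D$, the $\rho$-derivative of $f$ is $f^\ast(z)=\lim_{w\to z}\frac{d_\rho(f(z),f(w))}{|z-w|}=\rho(f(z))\,|f'(z)|$, $z\in\mathbb{D}$. For a continuous nonnegative function $g$ on $\mathbb{D}$ and $r\in(0,1)$, $m_p(r,g)=\left(\int_{-\pi}^{\pi}g(re^{it})^p\,dt\right)^{1/p}$. $\rho H^p$ is the set of analytic mappings $f:\mathbb{D}\to D$ such that $\sup_{r\in(0,1)}\left(\int_{-\pi}^{\pi}d_\rho(f(re^{it}),f(0))^p\,dt\right)^{1/p}$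 is finite. Under (1), $\rho H^p$ is contained in the classical Hardy space $H^p$, so for $f\in\rho H^p$ the radial limit $f_b(t)=\lim_{r\to1}f(re^{it})$ exists for a.e. $t$. $\rho\Lambda_\alpha^p$ is the class of all $2\pi$-periodic functions $\phi$ defined a.e. on $\mathbb{R}$ with values in $D$ such that $\sup_{s\in(0,h)}\left(\int_0^{2\pi}d_\rho(\phi(t+s),\phi(t))^p\,dt\right)^{1/p}=\mathcal{O}(h^\alpha)$ as $h\to0$ (so membership of $f_b$ includes $f_b(t)\in D$ for a.e. $t$). *)

(* Defs.v *)
From HB Require Import structures.
From mathcomp Require Import all_boot all_order all_algebra.
From mathcomp Require Import all_classical all_reals all_analysis.
From mathcomp Require Import complex.

Set Implicit Arguments.
Unset Strict Implicit.
Unset Printing Implicit Defensive.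

Import Order.TTheory GRing.Theory Num.Theory.
Import numFieldNormedType.Exports.

Local Open Scope classical_set_scope.
Local Open Scope ring_scope.
Local Open Scope complex_scope.

(* The usual topology of the plane: R[i] as a normed module over itself. *)
#[warnings="-redundant-canonical-projection"]
HB.instance Definition _ (R : rcfType) := NormedModule.copy R[i] R[i]^o.

Section Definitions.
Context {R : realType}.
Local Notation mu := (@lebesgue_measure R).
Local Notation C := (R[i]).
(* The modulus with values in R; the generic norm `|z| on R[i] is R[i]-valued. *)
Local Notation modulus := (@Normc.normc R).

Implicit Types (D : set C) (rho : C -> R) (p r h : R) (f : C -> C).

Definition unit_disk : set C := [set z | modulus z < 1].

Definition polar r (t : R) : C := (r * cos t) +i* (r * sin t).

Definition domain D : Prop := [/\ D !=set0, open D & connected D].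

Definition is_metric D rho : Prop :=
  (forall z, D z -> 0 < rho z) /\ {within D, continuous rho}.

(* g is C^1 on the closed interval [x, y]: its derivative on the interior
   extends continuously to [x, y]. *)
Definition C1_itv (x y : R) (g : R -> R) : Prop :=
  [/\ {within `[x, y], continuous g},
      {in `]x, y[, forall t, derivable g t 1} &
      exists2 dg : R -> R, {within `[x, y], continuous dg} &
        {in `]x, y[, forall t, derive1 g t = dg t}].

(* Continuity at the breakpoints is implied: consecutive closed pieces share
   their endpoint. *)
Definition piecewise_C1 (a b : R) (gamma : R -> C) : Prop :=
  exists2 s : seq R, itv_partition a b s &
    forall i, (i < size s)%N ->
      C1_itv (nth b (a :: s) i) (nth b (a :: s) i.+1)
             (fun t => complex.Re (gamma t)) /\
      C1_itv (nth b (a :: s) i) (nth b (a :: s) i.+1)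
             (fun t => complex.Im (gamma t)).

Definition curve_deriv (gamma : R -> C) (t : R) : C :=
  derive1 (fun u => complex.Re (gamma u)) t +i*
  derive1 (fun u => complex.Im (gamma u)) t.

(* curve_deriv is meaningless only at the finitely many breakpoints. *)
Definition rho_length rho (a b : R) (gamma : R -> C) : \bar R :=
  (\int[mu]_(t in `[a, b]) (rho (gamma t) * modulus (curve_deriv gamma t))%:E)%E.

Definition curve_joining D (zeta eta : C) (a b : R) (gamma : R -> C) : Prop :=
  [/\ piecewise_C1 a b gamma, {in `[a, b], forall t, D (gamma t)},
      gamma a = zeta & gamma b = eta].

(* Equal to +oo when no curve of D joins zeta and eta. *)
Definition rho_dist D rho (zeta eta : C) : \bar R :=
  ereal_inf [set l | exists a b gamma,
    curve_joining D zeta eta a b gamma /\ l = rho_length rho a b gamma].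

Definition extended_boundary D : set (one_point_compactification C) :=
  let D' := [set Some z | z in D] : set (one_point_compactification C) in
  closure D' `\` interior D'.

(* The filter "zeta --> boundary of D, zeta in D". *)
Definition to_boundary D : set_system C :=
  [set A | set_nbhs (extended_boundary D)
             [set xi | forall zeta, D zeta -> xi = Some zeta -> A zeta]].

Definition analytic_at f (z0 : C) : Prop :=
  exists c : nat -> C, \forall z \near z0,
    series (fun n => c n * (z - z0) ^+ n) @ \oo --> f z.

Definition analytic_mapping D f : Prop :=
  forall z, unit_disk z -> D (f z) /\ analytic_at f z.

Definition rho_deriv D rho f (z : C) : \bar R :=
  lim ((rho_dist D rho (f z) (f w) * ((modulus (z - w))^-1)%:E)%E @[w --> z^']).

Definition int_mean p r (g : C -> \bar R) : \bar R :=
  (poweR (\int[mu]_(t in `[(- pi)%R, pi%R]) poweR (g (polar r t)) p) (p^-1)%R)%E.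

Definition big_O (F : set_system R) (g : R -> \bar R) (k : R -> R) : Prop :=
  exists K : R, \forall x \near F, (`|g x| <= (K * `|k x|)%:E)%E.

Definition rho_Hp D rho p f : Prop :=
  analytic_mapping D f /\
  (ereal_sup [set int_mean p r (fun z => rho_dist D rho (f z) (f 0%R))
             | r in `]0%R, 1%R[] < +oo)%E.

Definition radial_limit_exists f (t : R) : Prop :=
  cvg (f (polar r t) @[r --> 1^'-]).

(* Meaningful only at those t for which radial_limit_exists f t. *)
Definition radial_limit f (t : R) : C := lim (f (polar r t) @[r --> 1^'-]).

Definition modulus_of_continuity D rho p (phi : R -> C) h : \bar R :=
  ereal_sup [set (poweR (\int[mu]_(t in `[0%R, (2 * pi)%R])
                     poweR (rho_dist D rho (phi (t + s)%R) (phi t)) p) (p^-1)%R)%E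
            | s in `]0, h[].

(* Lebesgue measurability, phrased through the Borel sets of R. *)
Definition lebesgue_measurable (phi : R -> C) : Prop :=
  exists u v : R -> R, [/\ measurable_fun setT u, measurable_fun setT v &
    {ae mu, forall t, phi t = u t +i* v t}].

(* An a.e. defined function is represented by a total one; its values on a null
   set, where it may leave D, affect neither the condition phi t \in D nor the
   integrals. *)
Definition rho_Lambda D rho p (alpha : R) (phi : R -> C) : Prop :=
  [/\ forall t, phi (t + 2 * pi) = phi t,
      lebesgue_measurable phi,
      {ae mu, forall t, D (phi t)} &
      big_O 0^'+ (modulus_of_continuity D rho p phi) (fun h => h `^ alpha)].

End Definitions.

(* Main.v *)
(* Write F(s, t) for the rho-derivative of f at s e^(it), which is
   rho(f) |f'| there, and bound the rho-distance by lengths of images of radii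
   and arcs under f.  Jensen's inequality with the weight (1 - s)^(alpha - 1),
   followed by Tonelli, turns the growth hypothesis into
     || int_r^1 F(s, .) ds ||_p <= K (1 - r)^alpha / alpha.
   For r = 0 this gives membership in rho H^p and, for almost every t, a finite
   rho-length of the image of the radius at t; since rho is bounded below the
   radial limit exists there, and it lies in D because the rho-distance to f(0)
   stays bounded along the radius.  No Hardy space theory is needed.
   For the modulus of continuity, join the boundary values at t + h and t by the
   image of the path that goes in along one radius to |z| = 1 - h, follows the
   arc of angle h, and goes out along the other radius. *)

Require Import Defs.
From HB Require Import structures.
From mathcomp Require Import all_boot all_order all_algebra.
From mathcomp Require Import all_classical all_reals all_analysis.
From mathcomp Require Import measurable_realfun complex.
From mathcomp Require Import ring lra.
Set Implicit Arguments.
Unset Strict Implicit.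
Unset Printing Implicit Defensive.
Import Order.TTheory GRing.Theory Num.Theory.
Import numFieldNormedType.Exports.
Local Open Scope classical_set_scope.
Local Open Scope ring_scope.

(** The radius 1 - h balances the costs: in L^p each radial piece costs the integral of K (1 -
    s)^(alpha - 1) over [1 - h, 1), that is K h^alpha / alpha, and the arc costs h times K h^(alpha
    - 1). The weight in Jensen's inequality is the growth rate itself, so w^(1 - p) (K w)^p
    collapses to K^p w and only the mass of w remains. Three obstacles shape the development. The
    rho-derivative is a limit of quotients of an infimum over curves and must first be identified
    with rho(f) |f'|, where rho is merely continuous. Integrands such as the speed of an arbitrary
    curve, or d_rho(f_b(t + h), f_b(t)) as a function of t, come with no measurability, so integrals
    are compared through measurable minorants. Finally, the image of a whole radius is not known to
    be an admissible curve, since it need not be C^1 up to its end; it is cut short and completed by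
    a small segment inside D. *)

Local Notation modulus := (@Normc.normc _).

(** * Complex numbers and analytic functions *)

Section Complex.
Context {R : realType}.
Implicit Types z w : R[i].

Lemma normcE z : `|z| = (modulus z)%:C%C.
Proof. by case: z. Qed.

Lemma normc_ge0 z : 0 <= modulus z.
Proof. by case: z => a b; exact: sqrtr_ge0. Qed.

Lemma normcD z w : modulus (z + w) <= modulus z + modulus w.
Proof. by rewrite -lecR rmorphD/= -!normcE ler_normD. Qed.

Lemma normcN z : modulus (- z) = modulus z.
Proof. by apply: complexI; rewrite -!normcE normrN. Qed.

Lemma normcB z w : modulus (z - w) = modulus (w - z).
Proof. by rewrite -normcN opprB. Qed.

Lemma normc_gt0 z : (0 < modulus z) = (z != 0).
Proof. by rewrite -ltcR -normcE normr_gt0. Qed.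

Lemma normcX z n : modulus (z ^+ n) = modulus z ^+ n.
Proof. by apply: complexI; rewrite rmorphXn/= -!normcE normrX. Qed.

Lemma nbhs_normcP z (A : set R[i]) :
  nbhs z A <-> exists2 e : R, 0 < e & forall w, modulus (z - w) < e -> A w.
Proof.
split => [/nbhs_normP[[a b]]|[e e0 H]]; last apply/nbhs_normP.
  rewrite /= ltcE/= => /andP[/eqP b0 a0 H]; exists a => // w zw; apply: H => /=.
  by rewrite normcE ltcE/= zw -b0 eqxx.
exists e%:C%C; first by rewrite /= ltcR.
by move=> w /=; rewrite normcE ltcR; exact: H.
Qed.
End Complex.

(** * Power series and strict derivatives *)

Section Analytic.
Context {R : realType}.
Implicit Types (z w L : R[i]) (f : R[i] -> R[i]).

(** Both points move, not only one. When this holds at every point of the disk, the derivative is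
    continuous there, which is how [df_continuous] is obtained. *)
Definition strict_deriv f z0 L := forall e : R, 0 < e ->
  exists2 d : R, 0 < d & forall z w, modulus (z - z0) < d ->
    modulus (w - z0) < d ->
    modulus (f z - f w - L * (z - w)) <= e * modulus (z - w).

Lemma normc_sum (I : Type) (r : seq I) (P : pred I) (F : I -> R[i]) :
  modulus (\sum_(i <- r | P i) F i) <= \sum_(i <- r | P i) modulus (F i).
Proof.
elim/big_ind2: _ => [|x1 x2 y1 y2 h1 h2|//]; first by rewrite Normc.normc0.
exact: le_trans (normcD _ _) (lerD _ _).
Qed.

Lemma normc_subX z w (d : R) n : modulus z <= d -> modulus w <= d ->
  modulus (z ^+ n.+1 - w ^+ n.+1) <= n.+1%:R * d ^+ n * modulus (z - w).
Proof.
move=> zd wd; rewrite subrXX Normc.normcM mulrC ler_wpM2r ?normc_ge0//.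
apply: le_trans (normc_sum _ _ _) _.
apply: (le_trans (y := \sum_(i < n.+1) d ^+ n)); last first.
  by rewrite sumr_const card_ord mulr_natl.
apply: ler_sum => i _; rewrite Normc.normcM !normcX.
have d0 : 0 <= d by exact: le_trans (normc_ge0 _) zd.
have iN : (i <= n)%N by rewrite -ltnS.
rewrite -[in leRHS](subnK iN) exprD ler_pM ?exprn_ge0 ?normc_ge0//.
  by rewrite lerXn2r ?nnegrE ?normc_ge0.
by rewrite lerXn2r ?nnegrE ?normc_ge0.
Qed.

Lemma cvgc_near (u : nat -> R[i]) l (e : R) : u @ \oo --> l -> 0 < e ->
  \forall n \near \oo, modulus (l - u n) < e.
Proof.
move=> ul e0; have : nbhs l [set w | modulus (l - w) < e].
  by apply/nbhs_normcP; exists e.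
by move/ul.
Qed.

Lemma geom_tail_le (q : R) n : 0 <= q <= 2^-1 ->
  \sum_(1 <= j < n.+1) q ^+ j <= 2 * q.
Proof.
move=> /andP[q0 q1].
(* The subtracted term makes the induction close: the step amounts to [2 * q <= 1]. *)
have H : \sum_(1 <= j < n.+1) q ^+ j <= 2 * q - 2 * q * q ^+ n.
  elim: n => [|n IH]; first by rewrite big_geq// expr0 mulr1 subrr.
  rewrite big_nat_recr//= (le_trans (lerD IH (lexx _)))// !exprS.
  have : 0 <= q * q ^+ n * (1 - 2 * q) by rewrite !mulr_ge0 ?exprn_ge0//; lra.
  lra.
apply: le_trans H _; rewrite gerBl mulr_ge0 ?exprn_ge0//; lra.
Qed.

(* Termwise, [|h^n - k^n| <= n d^(n-1) |h - k|], and [n <= 2^(n-1)] turns the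
   sum over [n >= 2] into a geometric tail that is small with [d]. *)
Lemma analytic_strict_deriv f z0 : analytic_at f z0 ->
  exists L, strict_deriv f z0 L.
Proof.
move=> [c /nbhs_normcP[r0 r0_gt0 cf]]; exists (c 1%N) => e e0.
pose r := r0 / 2; have r_gt0 : 0 < r by rewrite divr_gt0.
have rr0 : r < r0 by rewrite /r; lra.
clearbody r.
have normr (x : R) : 0 <= x -> modulus x%:C%C = x.
  by move=> x0; rewrite /= expr0n/= addr0 sqrtr_sqr ger0_norm.
(* The terms of the convergent series at [z0 + r] tend to 0, hence are bounded: this gives the
   Cauchy-type estimate |c_n| <= M / r^n. *)
have [M M0 cM] : exists2 M : R, 0 < M & forall n, modulus (c n) * r ^+ n <= M.
  have : cvgn (series (fun n => c n * (z0 + r%:C%C - z0) ^+ n)).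
    apply/cvg_ex; exists (f (z0 + r%:C%C)); apply: cf.
    by rewrite opprD addrA subrr add0r normcN normr// ltW.
  move=> /cvg_series_cvg_0 /cvgc_near/(_ (@ltr01 R))[N _ HN].
  have term n : modulus (c n * (z0 + r%:C%C - z0) ^+ n) = modulus (c n) * r ^+ n.
    by rewrite (addrC z0) addrK Normc.normcM normcX normr// ltW.
  have term_ge0 n : 0 <= modulus (c n) * r ^+ n by rewrite -term normc_ge0.
  exists (1 + \sum_(i < N) modulus (c i) * r ^+ i).
    by rewrite ltr_wpDr// sumr_ge0.
  move=> n; have [Nn|nN] := leqP N n.
    by have /= := HN n Nn; rewrite sub0r normcN term => /ltW/le_trans; apply;
      rewrite lerDl sumr_ge0.
  rewrite (bigD1 (Ordinal nN))//= addrCA lerDl addr_ge0// sumr_ge0//.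
(* The first bound makes the ratio [q = 2 * d / r] at most 1/2; the second absorbs the final
   constant 4 M d / r^2 into [e]. *)
pose d := Num.min (r / 4) (e * r ^+ 2 / (4 * M)).
have d0 : 0 < d.
  by rewrite lt_min divr_gt0//= divr_gt0 ?mulr_gt0 ?exprn_gt0.
have dr : d <= r / 4 by rewrite ge_min lexx.
have de : d <= e * r ^+ 2 / (4 * M) by rewrite ge_min lexx orbT.
exists d => // z w zd wd; apply/ler_addgt0Pr => t t0.
have t20 : 0 < t / 2 by rewrite divr_gt0.
have zr : modulus (z0 - z) < r0 by rewrite normcB; lra.
have wr : modulus (z0 - w) < r0 by rewrite normcB; lra.
(* Both values of [f] are replaced by partial sums at a cost of t/2 each; taking N + 2 terms ensures
   that degrees 0 and 1 are present and can be split off. *)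
have [N _ HN] := filterI (cvgc_near (cf z zr) t20) (cvgc_near (cf w wr) t20).
have {HN} [] := HN (N + 2)%N (leq_addr _ _).
rewrite addn2 /series/=.
set Sz := \sum_(0 <= k < N.+2) _; set Sw := \sum_(0 <= k < N.+2) _ => fz fw.
have -> : f z - f w - c 1%N * (z - w) =
  (f z - Sz) - (f w - Sw) + (Sz - Sw - c 1%N * (z - w)) by ring.
suff H : modulus (Sz - Sw - c 1%N * (z - w)) <= e * modulus (z - w).
  apply: le_trans (normcD _ _) _; have := normcD (f z - Sz) (- (f w - Sw)).
  rewrite normcN; lra.
have -> : Sz - Sw - c 1%N * (z - w) =
  \sum_(1 <= j < N.+1) c j.+1 * ((z - z0) ^+ j.+1 - (w - z0) ^+ j.+1).
  rewrite /Sz /Sw -sumrB big_nat_recl// big_ltn//= !expr0 subrr add0r !expr1.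
  rewrite -mulrBr; have -> : z - z0 - (w - z0) = z - w by ring.
  by rewrite addrAC subrr add0r; apply: eq_bigr => i _; rewrite mulrBr.
apply: le_trans (normc_sum _ _ _) _.
pose q := 2 * d / r.
have q0 : 0 <= q by rewrite /q divr_ge0 ?mulr_ge0 ?ltW.
apply: (le_trans (y := \sum_(1 <= j < N.+1) M / r * modulus (z - w) * q ^+ j)).
  apply: ler_sum => j _; rewrite Normc.normcM.
  have -> : z - w = (z - z0) - (w - z0) by ring.
  apply: le_trans (ler_wpM2l (normc_ge0 _) (normc_subX j (ltW zd) (ltW wd))) _.
  set m := modulus (z - z0 - (w - z0)).
  have cj : modulus (c j.+1) <= M / r ^+ j.+1.
    by rewrite ler_pdivlMr ?exprn_gt0.
  apply: (le_trans (ler_wpM2r _ cj)).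
    by rewrite !mulr_ge0 ?exprn_ge0 ?normc_ge0// ltW.
  have j2 : (j.+1%:R : R) <= 2 ^+ j by rewrite -natrX ler_nat ltn_expl.
  have -> : M / r * m * q ^+ j = M / r ^+ j.+1 * (2 ^+ j * d ^+ j * m).
    rewrite /q expr_div_n exprMn exprS invfM.
    by move: (r ^+ j)^-1 r^-1 => *; ring.
  apply: ler_wpM2l; first by rewrite divr_ge0 ?exprn_ge0// ltW.
  by rewrite !ler_wpM2r ?normc_ge0 ?exprn_ge0// ltW.
rewrite -mulr_sumr.
have q2 : q <= 2^-1 by rewrite /q ler_pdivrMr//; lra.
apply: (le_trans (ler_wpM2l _ (@geom_tail_le q N _))).
- by rewrite mulr_ge0 ?normc_ge0// divr_ge0// ltW.
- by rewrite q0.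
have -> : M / r * modulus (z - w) * (2 * q) = 4 * M * d / r ^+ 2 * modulus (z - w).
  by rewrite /q; field; rewrite gt_eqF.
rewrite ler_wpM2r ?normc_ge0// ler_pdivrMr ?exprn_gt0//.
by move: de; rewrite ler_pdivlMr ?mulr_gt0//; lra.
Qed.
End Analytic.

(** * Limits in the plane and derivatives of curves *)

Section ComplexTopology.
Context {R : realType}.
Implicit Types (z w : R[i]).

Lemma cvg_normcP (T : Type) (F : set_system T) (FF : Filter F)
    (g : T -> R[i]) (l : R[i]) :
  g @ F --> l <-> forall e : R, 0 < e -> \forall x \near F, modulus (l - g x) < e.
Proof.
split => [gl e e0|H A /nbhs_normcP[e e0 eA]].
  have : nbhs l [set w | modulus (l - w) < e] by apply/nbhs_normcP; exists e.
  by move/gl.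
by have := H _ e0; apply: filterS => x; exact: eA.
Qed.

Lemma cvg_at_normcP (g : R[i] -> R) z (l : R) : g w @[w --> z] --> l <->
  forall e : R, 0 < e -> exists2 d : R, 0 < d &
    forall w, modulus (z - w) < d -> `|l - g w| < e.
Proof.
have [H1 H2] := @cvgrPdist_lt R R _ (nbhs z) (nbhs_filter z) g l.
split=> [gl e e0|H]; first exact/nbhs_normcP/H1.
by apply: H2 => e e0; apply/nbhs_normcP/H.
Qed.

Lemma cvg_at_normcCP (g : R[i] -> R[i]) z (l : R[i]) : g w @[w --> z] --> l <->
  forall e : R, 0 < e -> exists2 d : R, 0 < d &
    forall w, modulus (z - w) < d -> modulus (l - g w) < e.
Proof.
have [H1 H2] := @cvg_normcP _ (nbhs z) (nbhs_filter z) g l.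
split=> [gl e e0|H]; first exact/nbhs_normcP/H1.
by apply: H2 => e e0; apply/nbhs_normcP/H.
Qed.

Lemma normr_Re_le z : `|complex.Re z| <= modulus z.
Proof.
case: z => a b /=; rewrite -sqrtr_sqr ler_wsqrtr// lerDl sqr_ge0//.
Qed.

Lemma normr_Im_le z : `|complex.Im z| <= modulus z.
Proof.
case: z => a b /=; rewrite -sqrtr_sqr ler_wsqrtr// lerDr sqr_ge0//.
Qed.

Lemma normc_le_ReIm z : modulus z <= `|complex.Re z| + `|complex.Im z|.
Proof.
case: z => a b /=; rewrite -[leRHS]ger0_norm ?addr_ge0// -sqrtr_sqr.
rewrite ler_wsqrtr// sqrrD !real_normK ?num_real// lerD2r lerDl.
by rewrite mulrn_wge0// mulr_ge0.
Qed.

Lemma ReB z w : complex.Re (z - w) = complex.Re z - complex.Re w.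
Proof. by case: z w => [? ?] [? ?]. Qed.

Lemma ImB z w : complex.Im (z - w) = complex.Im z - complex.Im w.
Proof. by case: z w => [? ?] [? ?]. Qed.

Lemma continuous_Re : continuous (@complex.Re R).
Proof.
move=> z; apply/cvg_at_normcP => e e0; exists e => // w.
by apply: le_lt_trans; rewrite -ReB normr_Re_le.
Qed.

Lemma continuous_Im : continuous (@complex.Im R).
Proof.
move=> z; apply/cvg_at_normcP => e e0; exists e => // w.
by apply: le_lt_trans; rewrite -ImB normr_Im_le.
Qed.

Lemma ler_normcB z w : `|modulus z - modulus w| <= modulus (z - w).
Proof.
rewrite ler_norml; apply/andP; split.
  by have := normcD (w - z) z; rewrite subrK normcB; lra.
by have := normcD (z - w) w; rewrite subrK; lra.
Qed.

Lemma continuous_normc : continuous (modulus : R[i] -> R).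
Proof.
move=> z; apply/cvg_at_normcP => e e0; exists e => // w.
by apply: le_lt_trans; exact: ler_normcB.
Qed.

Lemma cvg_ReIm (T : Type) (F : set_system T) (FF : Filter F)
    (g : T -> R[i]) (l : R[i]) :
  complex.Re (g x) @[x --> F] --> complex.Re l ->
  complex.Im (g x) @[x --> F] --> complex.Im l -> g @ F --> l.
Proof.
move=> gr gi; apply/cvg_normcP => e e0.
have e2 : 0 < e / 2 by rewrite divr_gt0.
move/cvgrPdist_lt : gr => /(_ _ e2) gr; move/cvgrPdist_lt : gi => /(_ _ e2) gi.
near=> x; apply: le_lt_trans (normc_le_ReIm _) _; rewrite ReB ImB.
rewrite (splitr e) ltrD//; near: x; [exact: gr|exact: gi].
Unshelve. all: by end_near. Qed.

(** The division-free form composes directly with [strict_deriv] in the chain rule; [cderivP]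
    translates it to real and imaginary parts, the form used by [C1_itv] and [curve_deriv]. *)
Definition cderiv (g : R -> R[i]) (t : R) (l : R[i]) := forall e : R, 0 < e ->
  \forall h \near (0 : R), modulus (g (h + t) - g t - h%:C%C * l) <= e * `|h|.

Lemma is_deriveP (g : R -> R) (t l : R) : is_derive t 1 g l <->
  forall e : R, 0 < e -> \forall h \near (0 : R), `|g (h + t) - g t - h * l| <= e * `|h|.
Proof.
have E (h : R) : h != 0 ->
    `|l - h^-1 *: (g (h *: 1 + t) - g t)| * `|h| = `|g (h + t) - g t - h * l|.
  move=> h0; have -> : h *: (1 : R) = h by exact: mulr1.
  rewrite -normrM -[RHS]normrN; congr `|_|.
  change (h^-1 *: (g (h + t) - g t)) with (h^-1 * (g (h + t) - g t)).
  by field.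
split => [[dg Dl] e e0|H].
  have : h^-1 *: (g (h *: 1 + t) - g t) @[h --> 0^'] --> l by rewrite -Dl; exact: dg.
  move=> /cvgrPdist_le/(_ _ e0); rewrite near_withinE; apply: filterS => h.
  have [->|h0 /(_ isT)] := eqVneq h 0.
    by rewrite add0r subrr mul0r subrr normr0 mulr0.
  by rewrite -E// ler_pM2r// normr_gt0.
have cv : h^-1 *: (g (h *: 1 + t) - g t) @[h --> 0^'] --> l.
  apply/cvgrPdist_le => e e0; rewrite near_withinE.
  have := H _ e0; apply: filterS => h + h0.
  by rewrite -E// ler_pM2r// normr_gt0.
apply: DeriveDef; first by apply/cvg_ex; exists l.
exact: cvg_lim cv.
Qed.

Lemma cderivP (g : R -> R[i]) t l : cderiv g t l <->
  is_derive t 1 (fun u => complex.Re (g u)) (complex.Re l) /\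
  is_derive t 1 (fun u => complex.Im (g u)) (complex.Im l).
Proof.
have ReM (h : R) z : complex.Re (h%:C%C * z) = h * complex.Re z.
  by case: z => a b /=; rewrite mul0r subr0.
have ImM (h : R) z : complex.Im (h%:C%C * z) = h * complex.Im z.
  by case: z => a b /=; rewrite mul0r addr0.
split=> [H|[/is_deriveP H1 /is_deriveP H2] e e0].
  split; apply/is_deriveP => e e0; have := H _ e0; apply: filterS => h;
  apply: le_trans.
    by rewrite -ReM -!ReB normr_Re_le.
  by rewrite -ImM -!ImB normr_Im_le.
have e2 : 0 < e / 2 by rewrite divr_gt0.
apply: filterS2 (H1 _ e2) (H2 _ e2) => h h1 h2.
apply: le_trans (normc_le_ReIm _) _; rewrite !ReB !ImB ReM ImM.
by rewrite (splitr e) mulrDl lerD.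
Qed.

Lemma cderiv_continuous (g : R -> R[i]) t l : cderiv g t l -> {for t, continuous g}.
Proof.
move=> /cderivP[[g1 _] [g2 _]].
by apply: cvg_ReIm; exact/differentiable_continuous/derivable1_diffP.
Qed.

Lemma cderiv_strict (f : R[i] -> R[i]) (g : R -> R[i]) t l L :
  strict_deriv f (g t) L -> cderiv g t l -> cderiv (fun u => f (g u)) t (L * l).
Proof.
move=> fL gl e e0.
have K0 : 0 < modulus L + modulus l + 2 by rewrite ltr_wpDl ?addr_ge0 ?normc_ge0.
(* The two error terms add up to e1 (e1 + |l| + |L|) |h|, which e1 <= 1 brings below e |h|. *)
pose e1 := Num.min 1 (e / (modulus L + modulus l + 2)).
have e1_gt0 : 0 < e1 by rewrite lt_min ltr01 divr_gt0.
have e1_le1 : e1 <= 1 by rewrite ge_min lexx.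
have e1_lee : e1 * (modulus L + modulus l + 2) <= e.
  by rewrite -ler_pdivlMr// ge_min lexx orbT.
have [d d0 fd] := fL _ e1_gt0.
have gc : \forall h \near 0, modulus (g t - g (h + t)) < d.
  have ht : h + t @[h --> (0 : R)] --> t.
    by rewrite -[X in _ --> X]add0r; apply: cvgD; [exact: cvg_id|exact: cvg_cst].
  have gt : g (h + t) @[h --> (0 : R)] --> g t.
    exact: cvg_comp ht (cderiv_continuous gl).
  by have /cvg_normcP/(_ _ d0) := gt.
apply: filterS2 gc (gl _ e1_gt0) => h h1 h2.
have := fd (g (h + t)) (g t).
rewrite subrr Normc.normc0 normcB => /(_ h1 d0) h3.
have -> : f (g (h + t)) - f (g t) - h%:C%C * (L * l) =
  (f (g (h + t)) - f (g t) - L * (g (h + t) - g t)) +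
  L * (g (h + t) - g t - h%:C%C * l) by ring.
apply: le_trans (normcD _ _) _; rewrite Normc.normcM.
have h4 : modulus (g (h + t) - g t) <= (e1 + modulus l) * `|h|.
  have -> : g (h + t) - g t = (g (h + t) - g t - h%:C%C * l) + h%:C%C * l by ring.
  apply: le_trans (normcD _ _) _; rewrite mulrDl lerD// Normc.normcM/=.
  by rewrite expr0n/= addr0 sqrtr_sqr mulrC.
have hl := normr_ge0 h; have L0 := normc_ge0 L; have l0 := normc_ge0 l.
have h5 := ler_wpM2l (ltW e1_gt0) h4; have h6 := ler_wpM2l L0 h2.
have h7 : e1 * (e1 + modulus l + modulus L) * `|h| <= e * `|h|.
  rewrite ler_wpM2r//; apply: le_trans e1_lee; rewrite ler_wpM2l ?ltW//; lra.
rewrite (normcB (g (h + t)) (g t)) in h5.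
lra.
Qed.
End ComplexTopology.

(** * Integrals of nonnegative functions on the line *)

Section NonMeasurable.
Local Open Scope ereal_scope.
Context d (T : measurableType d) (R : realType).
Variable mu : {measure set T -> \bar R}.
Implicit Types (D : set T) (f g : T -> \bar R).
Import HBNNSimple.

Lemma ge0_le_integral_nonmeas D f g : (forall x, D x -> 0 <= f x) ->
  (forall x, D x -> f x <= g x) ->
  \int[mu]_(x in D) f x <= \int[mu]_(x in D) g x.
Proof.
move=> f0 fg; have g0 x : D x -> 0 <= g x.
  by move=> Dx; exact: le_trans (f0 _ Dx) (fg _ Dx).
rewrite !ge0_integralE//=; apply: ge_ereal_sup => _ [h hf <-].
apply: ereal_sup_ubound; exists h => // x; apply: le_trans (hf x) _.
by rewrite !patchE; case: ifPn => // /set_mem; exact: fg.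
Qed.

Lemma sintegralT (h : {nnsfun T >-> R}) : sintegral mu h = \int[mu]_x (h x)%:E.
Proof. by rewrite integral_nnsfun// patch_setT. Qed.

(* The integral is a supremum over simple functions even when the integrand is
   not measurable; through minorants, integral inequalities hold without
   measurability, in particular for the lengths of arbitrary curves. *)
Lemma measurable_minorant D f : measurable D -> (forall x, D x -> 0 <= f x) ->
  exists g : T -> \bar R, [/\ measurable_fun [set: T] g, forall x, 0 <= g x,
    forall x, D x -> g x <= f x &
    \int[mu]_(x in D) f x = \int[mu]_(x in D) g x].
Proof.
move=> mD f0; pose S := [set sintegral mu h | h in
  [set h : {nnsfun T >-> R} | forall x, (h x)%:E <= (f \_ D) x]].
have fS : \int[mu]_(x in D) f x = ereal_sup S by rewrite ge0_integralE.
have fD0 x : 0 <= (f \_ D) x by apply: erestrict_ge0.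
have S0 : S != set0.
  by apply/set0P; exists 0; exists nnsfun0 => //; exact: sintegral0.
have [u uS ul] := ereal_sup_seq S0.
have /choice[h hP] : forall n, exists h : {nnsfun T >-> R},
    (forall x, (h x)%:E <= (f \_ D) x) /\ sintegral mu h = u n.
  by move=> n; have [h hf hu] := uS n; exists h.
(* The pointwise supremum of simple functions below [f] whose integrals tend to the supremum
   defining the integral of [f]. *)
exists (fun x => esups (fun n => (h n x)%:E) 0%N).
have hge n x : (h n x)%:E <= esups (fun n => (h n x)%:E) 0%N.
  by apply: ereal_sup_ubound; exists n.
have gf x : esups (fun n => (h n x)%:E) 0%N <= (f \_ D) x.
  by apply: ge_ereal_sup => _ [n _ <-]; exact: (hP n).1.
have g0 x : 0 <= esups (fun n => (h n x)%:E) 0%N.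
  by apply: le_trans (hge 0%N x); rewrite lee_fin.
split => //.
- apply: (@measurable_fun_esups _ _ _ _ (fun n x => (h n x)%:E)) => n.
  exact/measurable_EFinP.
- by move=> x Dx; apply: le_trans (gf x) _; rewrite patchE mem_set.
apply/eqP; rewrite eq_le; apply/andP; split; last first.
  apply: ge0_le_integral_nonmeas => // x Dx.
  by apply: le_trans (gf x) _; rewrite patchE mem_set.
rewrite fS -(cvg_lim _ ul)//; apply: lime_le; first exact: cvgP ul.
apply: nearW => n; rewrite -(hP n).2 sintegralT [leRHS]integral_mkcond.
apply: ge0_le_integral_nonmeas => [x _|x _]; first by rewrite lee_fin.
rewrite patchE; case: ifPn => xD; first exact: hge.
by apply: le_trans ((hP n).1 x) _; rewrite patchE (negbTE xD).
Qed.

(** Only the upper function has to be measurable: the a.e. comparison is applied to a measurable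
    minorant of [f]. This serves for the rho-distance between boundary values, as a function of the
    angle. *)
Lemma ge0_ae_le_integral_nonmeas D f g : measurable D ->
  (forall x, D x -> 0 <= f x) -> measurable_fun [set: T] g ->
  (forall x, 0 <= g x) -> {ae mu, forall x, D x -> f x <= g x} ->
  \int[mu]_(x in D) f x <= \int[mu]_(x in D) g x.
Proof.
move=> mD f0 mg g0 fg; have [h [mh h0 hf ->]] := measurable_minorant mD f0.
apply: ae_ge0_le_integral => //; [exact: measurable_funTS|exact: measurable_funTS|].
by apply: filterS fg => x fgx Dx; exact: le_trans (hf x Dx) (fgx Dx).
Qed.

(** A minorant on the union restricts to minorants on both pieces. An overlap, such as the common
    endpoint of two intervals, only enlarges the right-hand side. *)
Lemma ge0_integral_setU_le A B f : measurable A -> measurable B ->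
  (forall x, (A `|` B) x -> 0 <= f x) ->
  \int[mu]_(x in A `|` B) f x <= \int[mu]_(x in A) f x + \int[mu]_(x in B) f x.
Proof.
move=> mA mB f0.
have [|g [mg g0 gf ->]] := @measurable_minorant (A `|` B) f _ f0.
  exact: measurableU.
have mBA : measurable ((A `|` B) `\` A).
  by apply: measurableD => //; exact: measurableU.
have mgS (E : set T) : measurable_fun E g by exact: measurable_funTS.
rewrite -(setDUK (@subsetUl _ A B)) (ge0_integral_setU _ mA mBA)//; last first.
  by rewrite disj_set2E setDIK.
apply: leeD; first by apply: ge0_le_integral_nonmeas => // x Ax; apply: gf; left.
apply: (@le_trans _ _ (\int[mu]_(x in B) g x)).
  by apply: ge0_subset_integral => // x [[]].
by apply: ge0_le_integral_nonmeas => // x Ax; apply: gf; right.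
Qed.

(** Measurable minorants on two disjoint pieces glue to one on the union. *)
Lemma ge0_integral_setU_ge A B f : measurable A -> measurable B ->
  [disjoint A & B] -> (forall x, (A `|` B) x -> 0 <= f x) ->
  \int[mu]_(x in A) f x + \int[mu]_(x in B) f x <= \int[mu]_(x in A `|` B) f x.
Proof.
move=> mA mB AB f0.
have [x Ax|g [mg g0 gf ->]] := @measurable_minorant A f mA; first by apply: f0; left.
have [x Bx|h [mh h0 hf ->]] := @measurable_minorant B f mB; first by apply: f0; right.
pose k x := if x \in A then g x else h x.
have mk : measurable_fun setT k.
  apply: measurable_fun_ifT => //.
  by apply: (measurable_fun_bool true) => /=; rewrite setTI preimage_mem_true.
have -> : \int[mu]_(x in A) g x = \int[mu]_(x in A) k x.
  by apply: eq_integral => x xA; rewrite /k xA.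
have -> : \int[mu]_(x in B) h x = \int[mu]_(x in B) k x.
  apply: eq_integral => x xB; rewrite /k ifF//; apply/negbTE/negP => xA.
  move: AB; rewrite disj_set2E => /eqP; apply/eqP/set0P; exists x.
  by split; exact/set_mem.
have k0 x : 0 <= k x by rewrite /k; case: ifP.
rewrite -ge0_integral_setU//; last exact: measurable_funTS.
apply: ge0_le_integral_nonmeas => // x ABx; rewrite /k; case: ifPn => xA.
  by apply: gf; exact/set_mem.
by apply: hf; case: ABx => // /mem_set; rewrite (negbTE xA).
Qed.

Lemma ge0_subset_integral_nonmeas A B f : measurable A -> measurable B ->
  (forall x, B x -> 0 <= f x) -> A `<=` B ->
  \int[mu]_(x in A) f x <= \int[mu]_(x in B) f x.
Proof.
move=> mA mB f0 AB; rewrite integral_mkcond [leRHS]integral_mkcond.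
apply: ge0_le_integral_nonmeas => x _.
  by apply: erestrict_ge0 => y /AB; exact: f0.
by apply: restrict_lee => //; exact: f0.
Qed.

Lemma ge0_le_integralZl_nonmeas D f (c : R) : measurable D ->
  (forall x, D x -> 0 <= f x) -> (0 <= c)%R ->
  c%:E * \int[mu]_(x in D) f x <= \int[mu]_(x in D) (c%:E * f x).
Proof.
move=> mD f0 c0; have [g [mg g0 gf ->]] := measurable_minorant mD f0.
rewrite -ge0_integralZl_EFin//; last exact: measurable_funTS.
apply: ge0_le_integral_nonmeas => x Dx; first by rewrite mule_ge0 ?lee_fin.
by apply: lee_pmul => //; rewrite ?lee_fin//; exact: gf.
Qed.
End NonMeasurable.

(** * Translation, reflection and periodicity of integrals *)

Section AffineChange.
Local Open Scope ereal_scope.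
Context (R : realType).
Local Notation mu := (@lebesgue_measure R).
Implicit Types (f : R -> \bar R) (a b c : R).

Lemma measurable_fun_shift c : measurable_fun [set: R] (fun x : R => x + c)%R.
Proof. exact: measurable_funD. Qed.

Lemma lebesgue_measure_shift c (A : set R) : measurable A ->
  pushforward mu (fun x : R => (x + c)%R : measurableTypeR R) A = mu A.
Proof.
move=> mA; apply/esym/lebesgue_measure_unique => //=.
  exact: measurable_fun_shift.
move=> _ _ [[a b] _ <-].
rewrite /pushforward.
have -> : (fun x => (x + c)%R) @^-1` [set` `]a, b]] = [set` `](a - c)%R, (b - c)%R]].
  by apply/seteqP; split => x /=; rewrite !in_itv/= ltrBlDr lerBrDr.
rewrite !lebesgue_measure_itv/= !lte_fin ltrD2r -!EFinB.
by congr (if _ then _%:E else _); lra.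
Qed.

Lemma ge0_integral_shift c (D : set R) f : measurable D ->
  measurable_fun D f -> {in D, forall y, 0 <= f y} ->
  \int[mu]_(x in (fun x => x + c)%R @^-1` D) f (x + c)%R = \int[mu]_(x in D) f x.
Proof.
move=> mD mf f0; have ms := measurable_fun_shift c.
apply: (etrans (esym (@ge0_integral_pushforward _ _ (measurableTypeR R)
  (measurableTypeR R) R _ ms mu D f mD mf f0))).
by apply: eq_measure_integral => //= A mA AS; exact/lebesgue_measure_shift.
Qed.

Lemma ge0_integral_oppr (D : set R) f : measurable D ->
  measurable_fun D f -> {in D, forall y, 0 <= f y} ->
  \int[mu]_(x in (fun x => - x)%R @^-1` D) f (- x)%R = \int[mu]_(x in D) f x.
Proof.
move=> mD mf f0.
have mN : measurable_fun [set: R] (-%R : R -> R) by exact: oppr_measurable.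
apply: (etrans (esym (@ge0_integral_pushforward _ _ (measurableTypeR R)
  (measurableTypeR R) R _ mN mu D f mD mf f0))).
by apply: eq_measure_integral => //= A mA AS; exact: lebesgue_measureN.
Qed.

Lemma ge0_integral_itv_shift a b c f :
  measurable_fun `[(a + c)%R, (b + c)%R] f -> (forall y, (a + c <= y <= b + c)%R -> 0 <= f y) ->
  \int[mu]_(x in `[a, b]) f (x + c)%R = \int[mu]_(x in `[(a + c)%R, (b + c)%R]) f x.
Proof.
move=> mf f0.
have -> : `[a, b]%classic = (fun x => x + c)%R @^-1` `[(a + c)%R, (b + c)%R].
  by apply/seteqP; split => x /=; rewrite !in_itv/= !lerD2r.
apply: ge0_integral_shift => // y.
by rewrite inE/= in_itv/=; exact: f0.
Qed.

Lemma ge0_integral_itv_oppr a b f :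
  measurable_fun `[a, b] f -> (forall y, (a <= y <= b)%R -> 0 <= f y) ->
  \int[mu]_(x in `[(- b)%R, (- a)%R]) f (- x)%R = \int[mu]_(x in `[a, b]) f x.
Proof.
move=> mf f0.
have -> : `[(- b)%R, (- a)%R]%classic = (fun x => - x)%R @^-1` `[a, b].
  by rewrite opp_preimage_itvbndbnd.
apply: ge0_integral_oppr => // y.
by rewrite inE/= in_itv/=; exact: f0.
Qed.

Lemma ge0_integral_itv_shift_nonmeas a b c f :
  (forall y, (a + c <= y <= b + c)%R -> 0 <= f y) ->
  \int[mu]_(x in `[a, b]) f (x + c)%R <= \int[mu]_(x in `[(a + c)%R, (b + c)%R]) f x.
Proof.
move=> f0.
have [|x|g [mg g0 gf ->]] := @measurable_minorant _ _ _ mu `[a, b] (fun x => f (x + c)%R).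
- exact: measurable_itv.
- by rewrite /= in_itv/= => xab; apply: f0; rewrite !lerD2r.
pose h (x : R) := g (x - c)%R.
have mh : measurable_fun [set: R] h.
  by apply: (measurableT_comp mg); exact: measurable_fun_shift.
have -> : \int[mu]_(x in `[a, b]) g x = \int[mu]_(x in `[a, b]) h (x + c)%R.
  by apply: eq_integral => x _; rewrite /h addrK.
rewrite ge0_integral_itv_shift//; [|exact: measurable_funTS|by move=> y _; exact: g0].
apply: ge0_le_integral_nonmeas => x; first by move=> _; exact: g0.
rewrite /= in_itv/= => /andP[ax xb]; rewrite -{2}(subrK c x); apply: gf.
by rewrite /= in_itv/= lerBrDr ax lerBlDr xb.
Qed.

Lemma ge0_integral_itv_oppr_nonmeas a b f :
  (forall y, (a <= y <= b)%R -> 0 <= f y) ->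
  \int[mu]_(x in `[(- b)%R, (- a)%R]) f (- x)%R <= \int[mu]_(x in `[a, b]) f x.
Proof.
move=> f0.
have [|x|g [mg g0 gf ->]] := @measurable_minorant _ _ _ mu `[(- b)%R, (- a)%R] (fun x => f (- x)%R).
- exact: measurable_itv.
- by rewrite /= in_itv/= => xab; apply: f0; lra.
pose h (x : R) := g (- x)%R.
have mh : measurable_fun [set: R] h.
  by apply: (measurableT_comp mg); exact: oppr_measurable.
have -> : \int[mu]_(x in `[(- b)%R, (- a)%R]) g x = \int[mu]_(x in `[(- b)%R, (- a)%R]) h (- x)%R.
  by apply: eq_integral => x _; rewrite /h opprK.
rewrite ge0_integral_itv_oppr//; [|exact: measurable_funTS|by move=> y _; exact: g0].
apply: ge0_le_integral_nonmeas => x; first by move=> _; exact: g0.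
rewrite /= in_itv/= => /andP[ax xb]; rewrite -{2}(opprK x); apply: gf.
by rewrite /= in_itv/= !lerN2 ax xb.
Qed.

(** Lets a curve be examined on open intervals only: at a breakpoint [curve_deriv] of a glued curve
    need not be the derivative of either piece. *)
Lemma ge0_integral_itv_bndoo_nonmeas (b0 b1 : bool) a b f :
  (forall y, (a <= y <= b)%R -> 0 <= f y) ->
  \int[mu]_(x in [set` Interval (BSide b0 a) (BSide b1 b)]) f x =
  \int[mu]_(x in `]a, b[) f x.
Proof.
move=> f0.
have f0' (c0 c1 : bool) x : [set` Interval (BSide c0 a) (BSide c1 b)] x -> 0 <= f x.
  move=> xab; apply: f0; move: xab => /=; rewrite itv_boundlr.
  by case: c0; case: c1; rewrite !bnd_simp => /andP[]; lra.
apply/eqP; rewrite eq_le; apply/andP; split; last first.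
  apply: (ge0_subset_integral_nonmeas mu (measurable_itv _) (measurable_itv _) (f0' _ _)).
  by move=> x /=; rewrite in_itv/= itv_boundlr; case: b0; case: b1; rewrite !bnd_simp => /andP[]; lra.
have [g [mg g0 gf ->]] :=
  measurable_minorant mu (measurable_itv (Interval (BSide b0 a) (BSide b1 b))) (f0' b0 b1).
rewrite integral_itv_bndoo; last exact: measurable_funTS.
apply: ge0_le_integral_nonmeas => x; first by move=> _; exact: g0.
rewrite /= => xab; apply: gf => /=; move: xab.
by rewrite in_itv/= itv_boundlr; case: b0; case: b1; rewrite !bnd_simp => /andP[]; lra.
Qed.

(* A translation by a multiple of [P] brings [c] into [[c', c' + P)]; the part
   of the window beyond [c' + P] is then moved back by one period. *)
Lemma ge0_integral_periodic_le f (P c c' : R) : (0 < P)%R ->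
  measurable_fun [set: R] f -> (forall x, 0 <= f x) ->
  (forall x, f (x + P)%R = f x) ->
  \int[mu]_(x in `[c, (c + P)%R]) f x <= \int[mu]_(x in `[c', (c' + P)%R]) f x.
Proof.
move=> P0 mf f0 fP.
have fPz (k : int) x : f (x + k%:~R * P)%R = f x.
  have fPn (n : nat) y : f (y + n%:R * P)%R = f y.
    elim: n => [|n IH]; first by rewrite mul0r addr0.
    by rewrite -addn1 natrD mulrDl mul1r addrA fP.
  case: k => n; first exact: fPn.
  by rewrite NegzE mulrNz mulNr -[LHS](fPn n.+1) subrK.
have mfS (E : set R) : measurable_fun E f by exact: measurable_funTS.
have [k /andP[kc ck]] : exists k : int, (c' <= c - k%:~R * P < c' + P)%R.
  exists (Num.floor ((c - c') / P)).
  have := real_floor_itv (num_real ((c - c') / P)).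
  move: (Num.floor _) => m.
  rewrite intrD mulr1z ler_pdivlMr// ltr_pdivrMr// => /andP[]; rewrite mulrDl mul1r; lra.
set e := (c - k%:~R * P)%R in kc ck.
have -> : \int[mu]_(x in `[c, (c + P)%R]) f x = \int[mu]_(x in `[e, (e + P)%R]) f x.
  have cE : c = (e + k%:~R * P)%R by rewrite /e subrK.
  have -> : (c + P = e + P + k%:~R * P)%R by rewrite cE addrAC.
  by rewrite {1}cE -ge0_integral_itv_shift//; apply: eq_integral => x _; exact: fPz.
have -> : `[e, (e + P)%R]%classic = `[e, (c' + P)%R] `|` `[(c' + P)%R, (e + P)%R]%classic.
  apply/seteqP; split => x /=; rewrite !in_itv/=.
    by move=> /andP[ex xe]; have [xc|cx] := leP x (c' + P)%R; [left|right];
      rewrite ?ex ?xe ?(ltW cx).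
  by move=> [] /andP[h1 h2]; apply/andP; split; lra.
apply: le_trans (ge0_integral_setU_le _ _ _ _) _ => //.
rewrite -ge0_integral_itv_shift//.
under [X in _ + X]eq_integral do rewrite fP.
have sub : `[c', e] `|` `]e, (c' + P)%R] `<=` `[c', (c' + P)%R]%classic.
  by move=> x [] /=; rewrite !in_itv/= => /andP[h1 h2]; apply/andP; split; lra.
apply: le_trans (ge0_subset_integral_nonmeas mu
  (measurableU _ _ (measurable_itv _) (measurable_itv _)) (measurable_itv _)
  (fun x _ => f0 x) sub).
rewrite addeC; apply: le_trans (ge0_integral_setU_ge mu (measurable_itv _)
  (measurable_itv _) _ (fun x _ => f0 x)).
  by rewrite !ge0_integral_itv_bndoo_nonmeas.
rewrite disj_set2E; apply/eqP; apply/seteqP; split => // x [] /=.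
rewrite !in_itv/=; lra.
Qed.

End AffineChange.

(** * Curves and the rho-distance *)

Section Curves.
Context {R : realType}.
Local Notation mu := (@lebesgue_measure R).
Implicit Types (g dg : R -> R[i]) (D : set R[i]) (rho : R[i] -> R).

(** Stronger than [C1_itv] for both coordinates: the derivative is two-sided and continuous at the
    endpoints too. Segments, radii, arcs and their images satisfy this because they extend smoothly
    past their ends inside the disk or the plane. *)
Definition C1_curve (a b : R) g dg := forall t, a <= t <= b ->
  cderiv g t (dg t) /\ {for t, continuous dg}.

Lemma cderiv_curve_deriv g t l : cderiv g t l -> curve_deriv g t = l.
Proof.
move=> /cderivP[h1 h2]; rewrite /curve_deriv !derive1E.
by rewrite (@derive_val _ _ _ _ _ _ _ h1) (@derive_val _ _ _ _ _ _ _ h2); case: l {h1 h2}.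
Qed.

Lemma continuous_at_within (T U : topologicalType) (A : set T) (f : T -> U) :
  (forall x, A x -> {for x, continuous f}) -> {within A, continuous f}.
Proof.
move=> H; apply/subspace_continuousP => x Ax.
by apply: cvg_within_filter; exact: H.
Qed.

Lemma C1_curve_Re a b g dg : C1_curve a b g dg ->
  C1_itv a b (fun t => complex.Re (g t)).
Proof.
move=> H; split.
- apply: continuous_at_within => t /=; rewrite in_itv/= => /H[gt _].
  apply: continuous_comp; first exact: cderiv_continuous gt.
  exact: continuous_Re.
- move=> t; rewrite in_itv/= => /andP[/ltW at0 /ltW tb].
  by have [/cderivP[[? _] _] _] := H t (introT andP (conj at0 tb)).
- exists (fun t => complex.Re (dg t)).
    apply: continuous_at_within => t /=; rewrite in_itv/= => /H[_ gt].
    by apply: continuous_comp; [exact: gt|exact: continuous_Re].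
  move=> t; rewrite in_itv/= => /andP[/ltW at0 /ltW tb].
  have [/cderivP[h1 _] _] := H t (introT andP (conj at0 tb)).
  by rewrite derive1E (@derive_val _ _ _ _ _ _ _ h1).
Qed.

Lemma C1_curve_Im a b g dg : C1_curve a b g dg ->
  C1_itv a b (fun t => complex.Im (g t)).
Proof.
move=> H; split.
- apply: continuous_at_within => t /=; rewrite in_itv/= => /H[gt _].
  apply: continuous_comp; first exact: cderiv_continuous gt.
  exact: continuous_Im.
- move=> t; rewrite in_itv/= => /andP[/ltW at0 /ltW tb].
  by have [/cderivP[_ [? _]] _] := H t (introT andP (conj at0 tb)).
- exists (fun t => complex.Im (dg t)).
    apply: continuous_at_within => t /=; rewrite in_itv/= => /H[_ gt].
    by apply: continuous_comp; [exact: gt|exact: continuous_Im].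
  move=> t; rewrite in_itv/= => /andP[/ltW at0 /ltW tb].
  have [/cderivP[_ h1] _] := H t (introT andP (conj at0 tb)).
  by rewrite derive1E (@derive_val _ _ _ _ _ _ _ h1).
Qed.

Lemma eq_C1_itv (a b : R) (u v : R -> R) : {in `[a, b], u =1 v} ->
  C1_itv a b u -> C1_itv a b v.
Proof.
move=> uv [cu du [w cw dw]]; 
have near_uv t : t \in `]a, b[ -> \near t, u t = v t.
  move=> tab; apply: filterS (near_in_itvoo tab) => s; rewrite in_itv/= => sab.
  by apply: uv; rewrite in_itv/=; case/andP: sab => /ltW -> /ltW ->.
split.
- by apply: subspace_eq_continuous cu => t; rewrite inE; exact: uv.
- by move=> t tab; apply: near_eq_derivable (near_uv t tab) (du t tab).
- exists w => // t tab; rewrite -(dw t tab) !derive1E.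
  by apply/esym/near_eq_derive; exact: near_uv.
Qed.

Lemma near_eq_curve_deriv g1 g2 t : (\near t, g1 t = g2 t) ->
  curve_deriv g1 t = curve_deriv g2 t.
Proof.
move=> H; rewrite /curve_deriv !derive1E.
by congr Complex; apply: near_eq_derive; apply: filterS H => u ->.
Qed.

Lemma cderiv_shift g t k l : cderiv g (t + k) l -> cderiv (fun u => g (u + k)) t l.
Proof. by move=> H e e0; have := H _ e0; apply: filterS => h; rewrite !addrA. Qed.

Lemma cderivN g t l : cderiv g (- t) l -> cderiv (fun u => g (- u)) t (- l).
Proof.
move=> H e e0.
have N0 : - h @[h --> (0 : R)] --> (0 : R).
  by rewrite -[X in _ --> X]oppr0; apply: cvgN; exact: cvg_id.
have : \forall h \near (0 : R),
    modulus (g (- h + - t) - g (- t) - (- h)%:C%C * l) <= e * `|- h|.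
  exact: (N0 _ (H _ e0)).
apply: filterS => h.
by rewrite opprD normrN rmorphN mulrN mulNr.
Qed.

Lemma integrand_ge0 D rho z w : (forall z, D z -> 0 < rho z) -> D z ->
  (0 <= (rho z * modulus w)%:E)%E.
Proof. by move=> rho0 Dz; rewrite lee_fin mulr_ge0 ?normc_ge0// ltW// rho0. Qed.

Lemma rho_dist_ge0 D rho z w : (forall z, D z -> 0 < rho z) ->
  (0 <= rho_dist D rho z w)%E.
Proof.
move=> rho0; apply: le_ereal_inf_tmp => _ [a [b [g [[_ gD _ _] ->]]]].
apply: integral_ge0 => t tab.
by apply: (@integrand_ge0 D rho _ _ rho0); exact: gD.
Qed.

(** Any curve from [g b] to [z] can be preceded by the arc [g], so this is the triangle inequality
    with one distance already replaced by a length. *)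
Lemma rho_dist_prepend D rho a b g dg z : (forall z, D z -> 0 < rho z) ->
  a < b -> C1_curve a b g dg -> (forall t, a <= t <= b -> D (g t)) ->
  (rho_dist D rho (g a) z <=
   \int[mu]_(t in `[a, b]) (rho (g t) * modulus (dg t))%:E + rho_dist D rho (g b) z)%E.
Proof.
move=> rho0 ab gC1 gD; set I := (\int[mu]_(t in _) _)%E.
have I0 : (0 <= I)%E.
  apply: integral_ge0 => t tab.
  by apply: (@integrand_ge0 D rho _ _ rho0); apply: gD; move: tab; rewrite /= in_itv.
(* An arc of infinite length makes the claim trivial; a finite length can be moved to the other
   side, which leaves a lower bound for an infimum. *)
have [->|Ioo] := eqVneq I +oo%E.
  by rewrite addye ?leey// gt_eqF// (lt_le_trans _ (rho_dist_ge0 _ _ rho0)).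
have Ifin : I \is a fin_num by rewrite ge0_fin_numE// ltey.
rewrite -leeBlDl//; apply: le_ereal_inf_tmp => _ [c [d [h [[[s [cs /eqP sd] hC1] hD hc hd] ->]]]].
rewrite leeBlDl//.
(* Translation by [k] reparametrizes [g] on [[a', c]], so that it ends at the parameter where the
   given curve [h] starts. *)
pose k := b - c; pose a' := a - k.
have cd : c <= d by apply: (@itv_partition_le _ _ c d s); split => //; exact/eqP.
have ka : a' + k = a by rewrite subrK.
have kc : c + k = b by rewrite /k addrC subrK.
have a'c : a' < c by rewrite /a' /k; lra.
pose G t := if t <= c then g (t + k) else h t.
have Gh t : t \in `[c, d] -> G t = h t.
  rewrite in_itv/= => /andP[ct _]; rewrite /G; case: ifPn => // tc.
  have -> : t = c by apply/eqP; rewrite eq_le tc ct.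
  by rewrite kc hc.
have Gg t : t \in `[a', c] -> G t = g (t + k).
  by rewrite in_itv/= => /andP[_ tc]; rewrite /G tc.
have GD t : t \in `[a', d] -> D (G t).
  rewrite in_itv/= => /andP[at0 td]; have [tc|/ltW ct] := leP t c.
    by rewrite Gg ?in_itv/= ?at0//; apply: gD; rewrite -ka -kc !lerD2r at0 tc.
  by rewrite Gh ?in_itv/= ?ct//; apply: hD; rewrite in_itv/= ct.
have gkC1 : C1_curve a' c (fun t => g (t + k)) (fun t => dg (t + k)).
  move=> t; rewrite -(lerD2r k a') -(lerD2r k t c) ka kc => /gC1[gt dgt].
  split; first exact: cderiv_shift.
  apply: (@continuous_comp _ _ _ (fun t => t + k) dg) => //.
  by apply: cvgD; [exact: cvg_id|exact: cvg_cst].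
have Gcurve : curve_joining D (g a) z a' d G.
  split => //; last 2 first.
  - by rewrite Gg ?ka// in_itv/= lexx ltW.
  - by rewrite Gh ?hd// in_itv/= lexx andbT.
  exists (c :: s); first by split; [rewrite /= a'c|rewrite /= sd].
  case=> [_|i]; first split.
  - apply: (@eq_C1_itv _ _ (fun t => complex.Re (g (t + k)))) => [t tac|].
      by rewrite Gg.
    exact: C1_curve_Re gkC1.
  - apply: (@eq_C1_itv _ _ (fun t => complex.Im (g (t + k)))) => [t tac|].
      by rewrite Gg.
    exact: C1_curve_Im gkC1.
  rewrite ltnS => si; have [hr hi] := hC1 i si.
  have cds : itv_partition c d s by split => //; exact/eqP.
  have sub t : t \in `[nth d (c :: s) i, nth d (c :: s) i.+1] -> t \in `[c, d].
    rewrite !in_itv/= => /andP[h1 h2]; apply/andP; split.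
      by apply: le_trans h1; apply: (@itv_partition_nth_ge _ _ c d s i) => //; rewrite ltnS ltnW.
    by apply: le_trans h2 _; exact: (@itv_partition_nth_le _ _ c d s i.+1).
  split.
  - by apply: (@eq_C1_itv _ _ (fun t => complex.Re (h t))) => [t /sub tac|//]; rewrite Gh.
  - by apply: (@eq_C1_itv _ _ (fun t => complex.Im (h t))) => [t /sub tac|//]; rewrite Gh.
apply: (@le_trans _ _ (rho_length rho a' d G)).
  by apply: ereal_inf_lbound; exists a', d, G.
have G0 t : `[a', d]%classic t -> (0 <= (rho (G t) * modulus (curve_deriv G t))%:E)%E.
  by move=> tad; apply: (@integrand_ge0 D rho _ _ rho0); exact: GD.
have itvU : `[a', d]%classic = `[a', c]%classic `|` `[c, d]%classic.
  apply/seteqP; split => t /=; rewrite !in_itv/=.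
    by move=> /andP[h1 h2]; have [tc|/ltW ct] := leP t c; [left|right]; apply/andP.
  by move=> [] /andP[h1 h2]; apply/andP; split; lra.
rewrite /rho_length [X in integral _ X]itvU.
apply: le_trans (ge0_integral_setU_le mu (measurable_itv _) (measurable_itv _) _) _.
  by move=> t; rewrite -itvU; exact: G0.
(* On the open intervals [G] agrees with its piece near every point, so the derivatives agree; at
   the junction [c] they may not. *)
apply: leeD.
  rewrite ge0_integral_itv_bndoo_nonmeas; last first.
    by move=> t /andP[h1 h2]; apply: G0; rewrite /= in_itv/= h1 (le_trans h2).
  rewrite /I -ka -kc; apply: le_trans (ge0_integral_itv_shift_nonmeas _); last first.
    rewrite ka kc => t tab.
    by apply: (@integrand_ge0 D rho _ _ rho0); exact: gD.
  rewrite [leRHS]ge0_integral_itv_bndoo_nonmeas; last first.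
    move=> t tab; apply: (@integrand_ge0 D rho _ _ rho0); apply: gD.
    by rewrite -ka -kc !lerD2r.
  rewrite le_eqVlt; apply/orP; left; apply/eqP; apply: eq_integral => t.
  rewrite inE => tac0; have tac : t \in `]a', c[ by exact: tac0.
  congr (_ * modulus _)%:E.
    by rewrite Gg//; move: tac; rewrite !in_itv/= => /andP[/ltW -> /ltW ->].
  rewrite -(@cderiv_curve_deriv (fun t => g (t + k)) t (dg (t + k))); last first.
    apply: (gkC1 t _).1; move: tac; rewrite !in_itv/= => /andP[/ltW -> /ltW ->] //.
  apply: near_eq_curve_deriv; apply: filterS (near_in_itvoo tac) => u.
  by rewrite in_itv/= => /andP[/ltW h1 /ltW h2]; rewrite Gg// in_itv/= h1 h2.
rewrite [leLHS]ge0_integral_itv_bndoo_nonmeas; last first.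
  by move=> t /andP[h1 h2]; apply: G0; rewrite /= in_itv/= h2 (le_trans (ltW a'c)).
rewrite [leRHS]ge0_integral_itv_bndoo_nonmeas; last first.
  by move=> t tcd; apply: (@integrand_ge0 D rho _ _ rho0); apply: hD; rewrite in_itv.
rewrite le_eqVlt; apply/orP; left; apply/eqP; apply: eq_integral => t.
rewrite inE => tac0; have tac : t \in `]c, d[ by exact: tac0.
congr (rho _ * modulus _)%:E.
  by rewrite Gh//; move: tac; rewrite !in_itv/= => /andP[/ltW -> /ltW ->].
apply: near_eq_curve_deriv; apply: filterS (near_in_itvoo tac) => u.
by rewrite in_itv/= => /andP[/ltW h1 /ltW h2]; rewrite Gh// in_itv/= h1 h2.
Qed.

Lemma rho_dist_refl_le D rho z : D z -> (rho_dist D rho z z <= 0)%E.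
Proof.
move=> Dz; apply: ge_ereal_inf.
exists (rho_length rho 0 0 (fun=> z)); last first.
  by rewrite /rho_length set_itv1 integral_set1.
exists 0, 0, (fun=> z); split => //; split => //.
by exists [::].
Qed.

(** The arc is traversed backwards: t -> g(-t) on [-b, -a] is prepended. *)
Lemma rho_dist_prepend_rev D rho a b g dg z : (forall z, D z -> 0 < rho z) ->
  a < b -> C1_curve a b g dg -> (forall t, a <= t <= b -> D (g t)) ->
  (rho_dist D rho (g b) z <=
   \int[mu]_(t in `[a, b]) (rho (g t) * modulus (dg t))%:E + rho_dist D rho (g a) z)%E.
Proof.
move=> rho0 ab gC gD.
have gNC : C1_curve (- b) (- a) (fun t => g (- t)) (fun t => - dg (- t)).
  move=> t tba; have [|gt dgt] := gC (- t) _; first by lra.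
  split; first exact: cderivN.
  apply: cvgN; apply: (@continuous_comp _ _ _ (fun t => - t) dg) => //.
  by apply: cvgN; exact: cvg_id.
have gND t : - b <= t <= - a -> D (g (- t)) by move=> tba; apply: gD; lra.
have := rho_dist_prepend z rho0 (_ : - b < - a) gNC gND.
rewrite !opprK ltrN2 => /(_ ab) /le_trans; apply.
rewrite leeD2r//; apply: le_trans; last first.
  apply: (@ge0_integral_itv_oppr_nonmeas _ a b
    (fun t => (rho (g t) * modulus (dg t))%:E)) => t tab.
  by apply: (@integrand_ge0 D rho _ _ rho0); exact: gD.
apply: ge0_le_integral_nonmeas => t; rewrite ?normcN//.
rewrite /= in_itv/= => tab.
apply: (@integrand_ge0 D rho (g (- t)) (dg (- t)) rho0); exact: gND.
Qed.

(** The fundamental theorem of calculus applies to the component of [g] along the unit vector (p,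
    q), and Cauchy-Schwarz bounds its derivative by the speed. The direction of the chord is chosen
    in [C1_itv_length]. *)
Lemma C1_itv_FTC x y g (p q : R) : x < y ->
  C1_itv x y (fun t => complex.Re (g t)) -> C1_itv x y (fun t => complex.Im (g t)) ->
  p ^+ 2 + q ^+ 2 = 1 ->
  ((p * (complex.Re (g y) - complex.Re (g x)) +
    q * (complex.Im (g y) - complex.Im (g x)))%:E <=
   \int[mu]_(t in `[x, y]) (modulus (curve_deriv g t))%:E)%E.
Proof.
move=> xy [cu du [u' cu' u'E]] [cv dv [v' cv' v'E]] pq.
pose G t := p * complex.Re (g t) + q * complex.Im (g t).
pose w t := p * u' t + q * v' t.
have cw : {within `[x, y], continuous w}.
  move=> t; apply: cvgD; apply: cvgM; by [exact: cvg_cst|exact: cu'|exact: cv'].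
have cG : {within `[x, y], continuous G}.
  move=> t; apply: cvgD; apply: cvgM; by [exact: cvg_cst|exact: cu|exact: cv].
have dG t : t \in `]x, y[ -> is_derive t 1 G (w t).
  move=> txy; rewrite /w -u'E// -v'E// !derive1E.
  have := du t txy; have := dv t txy => /derivableP h1 /derivableP h2.
  exact: is_deriveD.
have FTC : (\int[mu]_(t in `[x, y]) (w t)%:E = (G y)%:E - (G x)%:E)%E.
  apply: (continuous_FTC2 xy cw).
    split; first by move=> t /dG[].
    - by have /continuous_within_itvP[] := cG.
    - by have /continuous_within_itvP[] := cG.
  by move=> t /dG h; rewrite derive1E (@derive_val _ _ _ _ _ _ _ h).
have -> : p * (complex.Re (g y) - complex.Re (g x)) +
    q * (complex.Im (g y) - complex.Im (g x)) = G y - G x by rewrite /G; ring.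
have mw : measurable_fun `[x, y] w.
  exact: subspace_continuous_measurable_fun.
rewrite EFinB -FTC; apply: le_trans (lee_abs _) _.
apply: le_trans (le_abse_integral _ _ _) _ => //; first exact/measurable_EFinP.
rewrite ge0_integral_itv_bndoo_nonmeas; last by move=> t _; rewrite lee_fin.
rewrite [leRHS]ge0_integral_itv_bndoo_nonmeas; last first.
  by move=> t _; rewrite lee_fin normc_ge0.
apply: ge0_le_integral_nonmeas => t; first by move=> _; rewrite lee_fin.
move=> txy0; have txy : t \in `]x, y[ by exact: txy0.
rewrite /curve_deriv u'E// v'E// lee_fin /w /= -sqrtr_sqr ler_wsqrtr//.
(* Lagrange's identity: this square is the defect in the Cauchy-Schwarz inequality. *)
have : 0 <= (p * v' t - q * u' t) ^+ 2 by rewrite sqr_ge0.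
have -> : u' t ^+ 2 + v' t ^+ 2 = (p ^+ 2 + q ^+ 2) * (u' t ^+ 2 + v' t ^+ 2).
  by rewrite pq mul1r.
lra.
Qed.

Lemma C1_itv_length x y g : x < y ->
  C1_itv x y (fun t => complex.Re (g t)) -> C1_itv x y (fun t => complex.Im (g t)) ->
  ((modulus (g y - g x))%:E <=
   \int[mu]_(t in `[x, y]) (modulus (curve_deriv g t))%:E)%E.
Proof.
move=> xy gr gi; set m := modulus _.
have [m0|m0] := eqVneq m 0.
  by rewrite m0; apply: integral_ge0 => t _; rewrite lee_fin normc_ge0.
have m_gt0 : 0 < m by rewrite lt_def m0 normc_ge0.
have m2 : m ^+ 2 = complex.Re (g y - g x) ^+ 2 + complex.Im (g y - g x) ^+ 2.
  by rewrite /m; case: (g y - g x) => a b /=; rewrite sqr_sqrtr// addr_ge0 ?sqr_ge0.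
have := @C1_itv_FTC x y g (complex.Re (g y - g x) / m) (complex.Im (g y - g x) / m)
  xy gr gi.
rewrite !expr_div_n -mulrDl -m2 divff ?expf_neq0// => /(_ erefl).
rewrite -ReB -ImB; congr (_ <= _)%E; congr EFin.
apply: (mulfI m0); rewrite -expr2 m2; by field.
Qed.

Lemma C1_itvS (x y x' y' : R) (u : R -> R) : x <= x' -> y' <= y ->
  C1_itv x y u -> C1_itv x' y' u.
Proof.
move=> xx yy [cu du [w cw dw]].
have sub : `[x', y'] `<=` `[x, y]%classic.
  by move=> t /=; rewrite !in_itv/= => /andP[h1 h2]; apply/andP; split; lra.
have subo t : t \in `]x', y'[ -> t \in `]x, y[.
  by rewrite !in_itv/= => /andP[h1 h2]; apply/andP; split; lra.
split; first exact: continuous_subspaceW cu.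
  by move=> t /subo; exact: du.
exists w; first exact: continuous_subspaceW cw.
by move=> t /subo; exact: dw.
Qed.

(** The intermediate time [t] matters: [rho_dist_ge] measures a curve up to a moment at which it is
    far from its starting point. *)
Lemma piecewise_C1_length a b g t : piecewise_C1 a b g -> a <= t <= b ->
  ((modulus (g t - g a))%:E <=
   \int[mu]_(u in `[a, t]) (modulus (curve_deriv g u))%:E)%E.
Proof.
move=> [s]; elim: s a => [|x s IH] a abs gC.
  rewrite (itv_partition_nil abs) => /andP[h1 h2].
  have -> : t = b by apply/eqP; rewrite eq_le h1 h2.
  by rewrite subrr Normc.normc0; apply: integral_ge0 => ? _; rewrite lee_fin normc_ge0.
have ax : a < x by case: abs => /= /andP[].
have xbs : itv_partition x b s by exact: itv_partition_cons abs.
move=> /andP[at0 tb].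
have [gr gi] := gC 0%N isT.
have [tx|xt] := leP t x.
  move: at0; rewrite le_eqVlt => /predU1P[<-|at0].
    by rewrite subrr Normc.normc0; apply: integral_ge0 => ? _; rewrite lee_fin normc_ge0.
  by apply: C1_itv_length => //; [apply: C1_itvS gr|apply: C1_itvS gi].
have IHt := IH x xbs (fun i (si : (i < size s)%N) => gC i.+1 si) (introT andP (conj (ltW xt) tb)).
have -> : g t - g a = (g x - g a) + (g t - g x) by ring.
apply: (@le_trans _ _ ((modulus (g x - g a))%:E + (modulus (g t - g x))%:E)%E).
  by rewrite -EFinD lee_fin normcD.
apply: le_trans (leeD (C1_itv_length ax gr gi) IHt) _.
have f0 (u : R) : (0 <= (modulus (curve_deriv g u))%:E)%E by rewrite lee_fin normc_ge0.
have -> : `[a, t]%classic = `[a, x]%classic `|` `]x, t]%classic.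
  apply/seteqP; split => u /=; rewrite !in_itv/=.
    by move=> /andP[h1 h2]; have [tc|ct] := leP u x; [left|right]; apply/andP.
  by move=> [] /andP[h1 h2]; apply/andP; split; lra.
apply: le_trans (ge0_integral_setU_ge mu (measurable_itv _) (measurable_itv _) _ (fun u _ => f0 u)).
  rewrite leeD2l// [leLHS]ge0_integral_itv_bndoo_nonmeas//.
  by rewrite [leRHS]ge0_integral_itv_bndoo_nonmeas.
rewrite disj_set2E; apply/eqP; apply/seteqP; split => // u [] /=.
rewrite !in_itv/=; lra.
Qed.

(** A curve from [z] that stays within distance [d] only meets values of rho above [c], and its
    Euclidean length is at least |w - z|. A curve that reaches distance [d] has already paid m d. *)
Lemma rho_dist_ge D rho z w (c m d : R) : 0 <= c -> 0 <= m ->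
  (forall y, D y -> m <= rho y) ->
  (forall y, D y -> modulus (y - z) < d -> c <= rho y) ->
  ((Num.min (c * modulus (w - z)) (m * d))%:E <= rho_dist D rho z w)%E.
Proof.
move=> c0 m0 mrho crho; apply: le_ereal_inf_tmp => _ [a [b [g [[gC gD ga gb] ->]]]].
have ab : a <= b by have [s abs _] := gC; exact: itv_partition_le abs.
have f0 (u : R) : (0 <= (modulus (curve_deriv g u))%:E)%E by rewrite lee_fin normc_ge0.
have scale (k : R) : 0 <= k -> (forall t, t \in `[a, b] -> k <= rho (g t)) ->
    (k%:E * \int[mu]_(u in `[a, b]) (modulus (curve_deriv g u))%:E <=
     rho_length rho a b g)%E.
  move=> k0 krho.
  apply: le_trans (ge0_le_integralZl_nonmeas mu (measurable_itv _) (fun u _ => f0 u) k0) _.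
  apply: ge0_le_integral_nonmeas => u uab; first by rewrite mule_ge0.
  by rewrite -EFinM lee_fin ler_wpM2r ?normc_ge0// krho.
have [near_z|] := pselect (forall t, t \in `[a, b] -> modulus (g t - z) < d).
  apply: le_trans (scale c c0 _); last first.
    by move=> t tab; apply: crho; [exact: gD|exact: near_z].
  apply: (@le_trans _ _ (c%:E * (modulus (w - z))%:E)%E).
    by rewrite -EFinM lee_fin ge_min lexx.
  rewrite -ga -gb; apply: lee_wpmul2l; first by rewrite lee_fin.
  by apply: piecewise_C1_length; [exact: gC|rewrite ab lexx].
move=> /existsNP[t /not_implyP[tab /negP]]; rewrite -leNgt => dt.
apply: le_trans (scale m m0 _); last by move=> u uab; apply: mrho; exact: gD.
apply: (@le_trans _ _ (m%:E * d%:E)%E).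
  by rewrite -EFinM lee_fin ge_min lexx orbT.
apply: lee_wpmul2l; first by rewrite lee_fin.
apply: (@le_trans _ _ (modulus (g t - g a))%:E); first by rewrite lee_fin ga.
apply: le_trans (piecewise_C1_length gC _) _; first by move: tab; rewrite in_itv.
apply: (ge0_subset_integral_nonmeas mu (measurable_itv _) (measurable_itv _) (fun u _ => f0 u)).
move=> u /=; rewrite !in_itv/= => /andP[-> ut]; apply: le_trans ut _.
by move: tab; rewrite in_itv/= => /andP[].
Qed.
End Curves.

(** * Local comparison with the Euclidean distance, and the rho-derivative *)

Section LocalMetric.
Context {R : realType}.
Local Notation mu := (@lebesgue_measure R).
Implicit Types (D : set R[i]) (rho : R[i] -> R) (z w : R[i]).

Lemma rho_dist_prepend_segment D rho z0 z w y (d M : R) :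
  (forall z, D z -> 0 < rho z) ->
  (forall u, modulus (u - z0) < d -> D u /\ rho u <= M) ->
  modulus (z - z0) < d -> modulus (w - z0) < d ->
  (rho_dist D rho z y <= (M * modulus (w - z))%:E + rho_dist D rho w y)%E.
Proof.
move=> rho0 dM zd wd.
pose g (t : R) := z + t%:C%C * (w - z).
have g0 : g 0 = z by rewrite /g rmorph0 mul0r addr0.
have g1 : g 1 = w by rewrite /g rmorph1 mul1r addrC subrK.
have gC : C1_curve 0 1 g (fun=> w - z).
  move=> t _; split; last exact: cvg_cst.
  move=> e e0; apply: (@nearW _ (nbhs (0 : R))) => h.
  have -> : g (h + t) - g t - h%:C%C * (w - z) = 0 by rewrite /g rmorphD/=; ring.
  by rewrite Normc.normc0 mulr_ge0// ltW.
have gd t : 0 <= t <= 1 -> modulus (g t - z0) < d.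
  move=> /andP[t0 t1].
  have -> : g t - z0 = (1 - t)%:C%C * (z - z0) + t%:C%C * (w - z0).
    by rewrite /g rmorphB/= rmorph1; ring.
  apply: le_lt_trans (normcD _ _) _; rewrite !Normc.normcM.
  have nR (x : R) : 0 <= x -> modulus x%:C%C = x.
    by move=> x0; rewrite /= expr0n/= addr0 sqrtr_sqr ger0_norm.
  rewrite !nR ?subr_ge0//; move: zd wd; set a := modulus (z - z0); set b := modulus (w - z0).
  (* One of the weights t and 1 - t is at least 1/2, which keeps the convex combination strictly
     below [d]. *)
  by move=> ad bd; have [t12|t12] := leP t (1/2); nra.
have := rho_dist_prepend y rho0 ltr01 gC (fun t t01 => (dM _ (gd t t01)).1).
rewrite g0 g1 => /le_trans; apply; apply: leeD2r.
apply: (@le_trans _ _ (\int[mu]_(t in `[0%R, 1%R]) (cst (M * modulus (w - z))%:E t))%E).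
  apply: ge0_le_integral_nonmeas => t t01.
    apply: (@integrand_ge0 _ D rho (g t) (w - z) rho0).
    by apply: (dM _ (gd t _)).1; move: t01; rewrite /= in_itv.
  rewrite lee_fin ler_wpM2r ?normc_ge0//.
  by apply: (dM _ (gd t _)).2; move: t01; rewrite /= in_itv.
rewrite integral_cst//=.
by rewrite lebesgue_measure_itv/= lte_fin ltr01 oppr0 adde0 mule1.
Qed.

Lemma rho_dist_le_segment D rho z0 z w (d M : R) :
  (forall z, D z -> 0 < rho z) ->
  (forall u, modulus (u - z0) < d -> D u /\ rho u <= M) ->
  modulus (z - z0) < d -> modulus (w - z0) < d ->
  (rho_dist D rho z w <= (M * modulus (w - z))%:E)%E.
Proof.
move=> rho0 dM zd wd.
apply: le_trans (rho_dist_prepend_segment w rho0 dM zd wd) _.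
rewrite -[leRHS]adde0 leeD2l//; apply: rho_dist_refl_le.
exact: (dM _ wd).1.
Qed.

Lemma metric_near D rho z (e : R) : open D -> {within D, continuous rho} -> D z ->
  0 < e -> exists2 d : R, 0 < d & forall w, modulus (w - z) < d ->
    D w /\ `|rho z - rho w| < e.
Proof.
move=> oD crho Dz e0.
have /cvg_at_normcP/(_ _ e0)[d d0 H] : {for z, continuous rho}.
  by move: crho; rewrite continuous_open_subspace// => /(_ z); apply; rewrite inE.
have /nbhs_normcP[d' d'0 H'] : nbhs z D by exact: open_nbhs_nbhs.
exists (Num.min d d'); first by rewrite lt_min d0.
move=> w; rewrite lt_min normcB => /andP[h1 h2].
by split; [exact: H'|exact: H].
Qed.

Lemma dnbhs_normcP z (A : set R[i]) : (exists2 e : R, 0 < e &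
  forall w, w != z -> modulus (z - w) < e -> A w) -> dnbhs z A.
Proof.
move=> [e e0 H]; suff : nbhs z (fun w => w != z -> A w) by [].
by apply/nbhs_normcP; exists e => // w zw wz; exact: H.
Qed.

Lemma dnbhsC_proper z : ProperFilter (dnbhs z).
Proof. exact: (Proper_dnbhs_numFieldType (z : R[i]^o)). Qed.

(* Curves that leave a small ball around [f z] are long because [rho] is
   bounded below, so only the values of [rho] close to [f z] matter. *)
Lemma rho_deriv_strict D rho f z L (m : R) : open D -> is_metric D rho ->
  0 < m -> (forall y, D y -> m <= rho y) -> D (f z) -> strict_deriv f z L ->
  rho_deriv D rho f z = (rho (f z) * modulus L)%:E.
Proof.
move=> oD [rho0 crho] m0 mrho Dfz fL; set r := rho (f z).
have r0 : 0 < r by exact: rho0.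
have L0 := normc_ge0 L.
have FF := dnbhsC_proper z.
apply: cvg_lim => //.
suff H (e : R) : 0 < e -> \forall w \near z^', exists2 x : R,
    (rho_dist D rho (f z) (f w) * (modulus (z - w))^-1%:E)%E = x%:E &
    `|r * modulus L - x| <= e.
  apply/fine_cvgP; split.
    by have := H _ ltr01; apply: filterS => w [x -> _].
  apply/cvgrPdist_le => e e0; have := H _ e0.
  by apply: filterS => w [x E]; rewrite /= E.
move=> e0.
(* The quotient will lie between (r - e1) (|L| - e1) and (r + e1) (|L| + e1), whose distance to r
   |L| is at most e1 (r + |L| + 1) <= e; e1 <= r keeps the lower bound on rho nonnegative. *)
pose e1 := Num.min (Num.min 1 r) (e / (r + modulus L + 1)).
have K0 : 0 < r + modulus L + 1 by lra.
have e1_gt0 : 0 < e1 by rewrite !lt_min ltr01 r0 divr_gt0.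
have e1_le1 : e1 <= 1 by rewrite !ge_min lexx.
have e1_ler : e1 <= r by rewrite !ge_min lexx orbT.
have e1_lee : e1 * (r + modulus L + 1) <= e.
  by rewrite -ler_pdivlMr// ge_min lexx orbT.
have [d1 d1_gt0 Hd1] := metric_near oD crho Dfz e1_gt0.
have [d2 d2_gt0 Hd2] := fL _ e1_gt0.
(* The first bound keeps [f w] in the ball where rho is within [e1] of [r]. The second keeps (r -
   e1) |f w - f z| below m d1, so the minimum in [rho_dist_ge] is its first entry. *)
pose d3 := Num.min (d1 / (modulus L + 1)) (m * d1 / (r * (modulus L + 1))).
have d3_gt0 : 0 < d3 by rewrite lt_min !divr_gt0 ?mulr_gt0//; lra.
apply: dnbhs_normcP; exists (Num.min d2 d3); first by rewrite lt_min d2_gt0.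
move=> w wz; rewrite lt_min => /andP[wd2 wd3].
set n := modulus (z - w) in wd2 wd3 *.
have n0 : 0 < n by rewrite normc_gt0 subr_eq0 eq_sym.
have := Hd2 z w; rewrite subrr Normc.normc0 normcB -/n => /(_ d2_gt0) Hzw.
have {}Hzw := Hzw wd2.
have up : modulus (f w - f z) <= (modulus L + e1) * n.
  have -> : f w - f z = - ((f z - f w - L * (z - w)) + L * (z - w)) by ring.
  rewrite normcN; apply: le_trans (normcD _ _) _.
  rewrite Normc.normcM -/n; lra.
have lo : (modulus L - e1) * n <= modulus (f w - f z).
  have := normcD (f z - f w) (- (f z - f w - L * (z - w))).
  have -> : f z - f w + - (f z - f w - L * (z - w)) = L * (z - w) by ring.
  rewrite Normc.normcM normcN (normcB (f z)) -/n; lra.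
have nL : (modulus L + e1) * n <= (modulus L + 1) * n.
  by rewrite ler_wpM2r ?(ltW n0)// lerD2l.
have fwd1 : modulus (f w - f z) < d1.
  apply: le_lt_trans (le_trans up nL) _.
  rewrite mulrC -ltr_pdivlMr; last lra.
  by apply: lt_le_trans wd3 _; rewrite ge_min lexx.
have ub : (rho_dist D rho (f z) (f w) <= ((r + e1) * modulus (f w - f z))%:E)%E.
  apply: (rho_dist_le_segment (z0 := f z) (d := d1)) => //.
    move=> u /Hd1[Du ru]; split => //; move: ru; rewrite -/r ltr_norml; lra.
  by rewrite subrr Normc.normc0.
have lb : (((r - e1) * modulus (f w - f z))%:E <= rho_dist D rho (f z) (f w))%E.
  have := @rho_dist_ge _ D rho (f z) (f w) (r - e1) m d1.
  rewrite subr_ge0 => /(_ e1_ler (ltW m0) mrho).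
  have h : forall y, D y -> modulus (y - f z) < d1 -> r - e1 <= rho y.
    by move=> y _ /Hd1[_]; rewrite -/r ltr_norml; lra.
  move=> /(_ h); rewrite min_l//.
  apply: (@le_trans _ _ (r * ((modulus L + 1) * n))).
    apply: ler_pM; rewrite ?normc_ge0 ?subr_ge0//; first by rewrite gerBl ltW.
    exact: le_trans up nL.
  have : n < m * d1 / (r * (modulus L + 1)).
    by apply: lt_le_trans wd3 _; rewrite ge_min lexx orbT.
  rewrite ltr_pdivlMr ?mulr_gt0//; last lra.
  by move=> /ltW; congr (_ <= _); ring.
have Dfin : rho_dist D rho (f z) (f w) \is a fin_num.
  rewrite ge0_fin_numE; last exact: rho_dist_ge0.
  by apply: le_lt_trans ub _; rewrite ltry.
move: ub lb; rewrite -(fineK Dfin) !lee_fin; set x := fine _ => ub lb.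
exists (x * n^-1); first by rewrite EFinM.
have xn : x = x / n * n by rewrite divfK// gt_eqF.
set q := x / n in xn *.
have q1 : q <= (r + e1) * (modulus L + e1).
  rewrite -(ler_pM2r n0) -xn; apply: le_trans ub _; rewrite -mulrA ler_wpM2l//; lra.
have q2 : (r - e1) * (modulus L - e1) <= q.
  rewrite -(ler_pM2r n0) -xn; apply: le_trans lb; rewrite -mulrA ler_wpM2l//; lra.
have e12 : e1 * e1 <= e1 by rewrite -[leRHS]mulr1 ler_wpM2l// ltW.
have e120 : 0 <= e1 * e1 by rewrite mulr_ge0// ltW.
rewrite ler_norml; apply/andP; split; lra.
Qed.
End LocalMetric.

(** * A weighted Minkowski inequality *)

Section MeasureTools.
Context {R : realType}.
Local Notation mu := (@lebesgue_measure R).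

(** Rational boxes form a countable base of the plane. *)
Lemma open_measurable_prod (U : set (R * R)) : open U -> measurable U.
Proof.
move=> oU.
pose box (q : (rat * rat) * (rat * rat)) : set (R * R) :=
  `](ratr q.1.1 : R), ratr q.1.2[%classic `*` `](ratr q.2.1 : R), ratr q.2.2[%classic.
have -> : U = \bigcup_(q in [set q | box q `<=` U]) box q.
  apply/seteqP; split => [[x y] Uxy|x [q /= qU /qU]//].
  have /nbhs_ballP[e /= e0 eU] : nbhs (x, y) U by exact: open_nbhs_nbhs.
  have [q1 h1] : exists q : rat, ratr q \in `]x - e, x[ by apply: rat_in_itvoo; lra.
  have [q2 h2] : exists q : rat, ratr q \in `]x, x + e[ by apply: rat_in_itvoo; lra.
  have [q3 h3] : exists q : rat, ratr q \in `]y - e, y[ by apply: rat_in_itvoo; lra.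
  have [q4 h4] : exists q : rat, ratr q \in `]y, y + e[ by apply: rat_in_itvoo; lra.
  move: h1 h2 h3 h4; rewrite !in_itv/= => /andP[a1 a2] /andP[a3 a4] /andP[a5 a6] /andP[a7 a8].
  exists ((q1, q2), (q3, q4)); last by split; rewrite /= in_itv/= ?a2 ?a3 ?a6 ?a7.
  move=> [u v] [/=]; rewrite !in_itv/= => /andP[b1 b2] /andP[b3 b4].
  by apply: eU; split => /=; rewrite /ball/= ltr_norml; lra.
rewrite bigcup_mkcond; apply: countable_bigcupT_measurable => //.
move=> q; case: ifPn => // _; apply: measurableX; exact: measurable_itv.
Qed.

Lemma continuous_measurable_prod (A : set (R * R)) (f : R * R -> R) : open A ->
  (forall x, A x -> {for x, continuous f}) -> measurable_fun A f.
Proof.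
move=> oA cf mA; apply: (measurability _ (RGenOpens.measurableE R)) => //.
move=> _ [_ [a [b ->] <-]]; apply: open_measurable_prod.
rewrite openE => x [Ax fx]; apply: filterI; first exact: open_nbhs_nbhs.
apply: (cf x Ax); apply: open_nbhs_nbhs; split => //; exact: interval_open.
Qed.

(** Hölder's inequality for the factorization h = (h w^(-1/q)) w^(1/q), with 1/p + 1/q = 1; the p-th
    power of the first factor is h^p w^(1 - p). The case p = 1, where q is infinite, is treated
    apart. *)
Lemma hoelder_weight (I : set R) (h w : R -> R) (p W : R) : 1 <= p -> measurable I ->
  measurable_fun [set: R] h -> measurable_fun [set: R] w ->
  (forall s, 0 <= h s) -> (forall s, I s -> 0 < w s) -> 0 <= W ->
  (\int[mu]_(s in I) (w s)%:E <= W%:E)%E ->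
  ((\int[mu]_(s in I) (h s)%:E) `^ p <=
   (W `^ (p - 1))%:E * \int[mu]_(s in I) (h s `^ p * w s `^ (1 - p))%:E)%E.
Proof.
move=> p1 mI mh mw h0 w0 W0 wW.
have p0 : 0 < p by lra.
have [p_eq1|pn1] := eqVneq p 1.
  rewrite p_eq1 subrr powRr0 mul1e poweRe1; last first.
    by apply: integral_ge0 => s _; rewrite lee_fin.
  apply: ge0_le_integral_nonmeas => s Is; first by rewrite lee_fin.
  by rewrite powRr0 mulr1 powRr1.
have p_gt1 : 1 < p by rewrite lt_def pn1.
pose q := p / (p - 1).
have q0 : 0 < q by rewrite /q divr_gt0//; lra.
have pq : p^-1 + q^-1 = 1 by rewrite /q invf_div; field; lra.
pose f s := h s * w s `^ (- q^-1) * \1_I s.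
pose g s := w s `^ (q^-1) * \1_I s.
have mf : measurable_fun [set: R] f.
  apply: measurable_funM; [apply: measurable_funM => //|exact: measurable_indic].
  by apply: (measurableT_comp (measurable_powR _)).
have mg : measurable_fun [set: R] g.
  apply: measurable_funM; [|exact: measurable_indic].
  by apply: (measurableT_comp (measurable_powR _)).
have := hoelder mu mf mg p0 q0 pq.
have -> : Lnorm mu 1 (EFin \o (f \* g)) = (\int[mu]_(s in I) (h s)%:E)%E.
  rewrite Lnorm1 [RHS]integral_mkcond; apply: eq_integral => s _ /=.
  rewrite patchE /f /g indicE; case: ifPn => sI; last by rewrite !mulr0 normr0.
  rewrite !mulr1 -mulrA -powRD ?addNr ?powRr0 ?mulr1 ?ger0_norm//.
  by rewrite eqxx /= gt_eqF// w0//; exact: set_mem.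
have -> : Lnorm mu p%:E (EFin \o f) =
    ((\int[mu]_(s in I) (h s `^ p * w s `^ (1 - p))%:E) `^ p^-1)%E.
  rewrite unlock; congr poweR; rewrite [RHS]integral_mkcond; apply: eq_integral => s _ /=.
  rewrite patchE /f indicE; case: ifPn => sI; last by rewrite mulr0 normr0 powR0// gt_eqF.
  rewrite mulr1 ger0_norm ?mulr_ge0 ?powR_ge0// powRM ?powR_ge0// -powRrM.
  congr (_ * _ `^ _)%:E; rewrite /q invf_div; field; lra.
have -> : Lnorm mu q%:E (EFin \o g) = ((\int[mu]_(s in I) (w s)%:E) `^ q^-1)%E.
  rewrite unlock; congr poweR; rewrite [RHS]integral_mkcond; apply: eq_integral => s _ /=.
  rewrite patchE /g indicE; case: ifPn => sI; last by rewrite mulr0 normr0 powR0// gt_eqF.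
  rewrite mulr1 ger0_norm ?powR_ge0// -powRrM mulVf ?gt_eqF// powRr1//.
  by rewrite ltW// w0//; exact: set_mem.
move=> H.
have A0 : (0 <= \int[mu]_(s in I) (h s `^ p * w s `^ (1 - p))%:E)%E.
  by apply: integral_ge0 => s _; rewrite lee_fin mulr_ge0 ?powR_ge0.
have w0' : (0 <= \int[mu]_(s in I) (w s)%:E)%E.
  by apply: integral_ge0 => s Is; rewrite lee_fin ltW// w0.
apply: (@le_trans _ _ ((((\int[mu]_(s in I) (h s `^ p * w s `^ (1 - p))%:E) `^ p^-1) *
   (\int[mu]_(s in I) (w s)%:E) `^ q^-1) `^ p)%E).
  apply: gt0_ler_poweR => //; rewrite ?in_itv/= ?andbT ?leey ?andbT; first lra.
  - by apply: integral_ge0 => s _; rewrite lee_fin.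
  - by rewrite mule_ge0// poweR_ge0.
rewrite poweRM ?poweR_ge0// -!poweRrM mulVf ?gt_eqF// poweRe1// muleC.
apply: lee_wpmul2r => //.
have -> : q^-1 * p = p - 1 by rewrite /q invf_div; field; lra.
rewrite -poweR_EFin; apply: gt0_ler_poweR => //; rewrite ?in_itv/= ?andbT ?leey ?andbT//; lra.
Qed.

(* A form of Minkowski's integral inequality: Jensen for the measure [w ds],
   then Tonelli. *)
Lemma integral_minkowski_weight (H : R * R -> R) (w : R -> R) (I J : set R) (p K W : R) :
  1 <= p -> measurable I -> measurable J -> measurable_fun [set: R * R] H ->
  measurable_fun [set: R] w -> (forall x, 0 <= H x) -> (forall s, I s -> 0 < w s) ->
  0 <= K -> 0 <= W -> (\int[mu]_(s in I) (w s)%:E <= W%:E)%E ->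
  (forall s, I s -> (\int[mu]_(t in J) (H (s, t) `^ p)%:E <= ((K * w s) `^ p)%:E)%E) ->
  (\int[mu]_(t in J) ((\int[mu]_(s in I) (H (s, t))%:E) `^ p) <= ((K * W) `^ p)%:E)%E.
Proof.
move=> p1 mI mJ mH mw H0 w0 K0 W0 wW HJ.
have p0 : 0 < p by lra.
have mHs t : measurable_fun [set: R] (fun s => H (s, t)) by exact: measurable_fun_pair1.
(* The indicators carry the restriction to I x J, so that Tonelli applies on the whole plane. *)
pose Q (x : R * R) : \bar R := (H x `^ p * w x.1 `^ (1 - p) * \1_I x.1 * \1_J x.2)%:E.
have mQ : measurable_fun [set: R * R] Q.
  apply/measurable_EFinP; apply: measurable_funM;
    [apply: measurable_funM; [apply: measurable_funM|]|].
  - by apply: (measurableT_comp (measurable_powR _)).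
  - by apply: (measurableT_comp (measurable_powR _)); exact: measurableT_comp.
  - by apply: measurableT_comp => //; exact: measurable_indic.
  - by apply: measurableT_comp => //; exact: measurable_indic.
have Q0 x : (0 <= Q x)%E by rewrite lee_fin !mulr_ge0 ?powR_ge0.
apply: (@le_trans _ _ (\int[mu]_(t in J) ((W `^ (p - 1))%:E * \int[mu]_s Q (s, t)))%E).
  apply: ge0_le_integral_nonmeas => t Jt; first exact: poweR_ge0.
  apply: le_trans (hoelder_weight p1 mI (mHs t) mw _ w0 W0 wW) _ => //.
  rewrite le_eqVlt; apply/orP; left; apply/eqP; congr (_ * _)%E.
  rewrite integral_mkcond; apply: eq_integral => s _.
  rewrite patchE /Q /= !indicE (mem_set Jt) mulr1.
  by case: ifPn => _; rewrite ?mulr1 ?mulr0.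
have mG : measurable_fun [set: R] (fun t => \int[mu]_s Q (s, t))%E.
  exact: measurable_fun_fubini_tonelli_G.
have G0 t : (0 <= \int[mu]_s Q (s, t))%E by exact: integral_ge0.
rewrite ge0_integralZl_EFin//; [|exact: measurable_funTS|exact: powR_ge0].
apply: (@le_trans _ _ ((W `^ (p - 1))%:E * \int[mu]_t \int[mu]_s Q (s, t))%E).
  apply: lee_wpmul2l; first by rewrite lee_fin powR_ge0.
  exact: ge0_subset_integral.
rewrite -fubini_tonelli//.
(* On the slice at [s] the hypothesis gives w^(1 - p) (K w)^p = K^p w. Integration over [I] then
   yields K^p W, and the outer factor completes it to K^p W^p. *)
apply: (@le_trans _ _ ((W `^ (p - 1))%:E * \int[mu]_(s in I) ((K `^ p)%:E * (w s)%:E))%E).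
  apply: lee_wpmul2l; first by rewrite lee_fin powR_ge0.
  rewrite [leRHS]integral_mkcond; apply: ge0_le_integral_nonmeas => s _.
    exact: integral_ge0.
  rewrite patchE; case: ifPn => sI; last first.
    by rewrite (eq_integral (cst 0%E)) ?integral0// => t _; rewrite /Q /= indicE (negbTE sI) mulr0 mul0r.
  have Is := set_mem sI.
  have -> : (\int[mu]_t Q (s, t) = (w s `^ (1 - p))%:E * \int[mu]_(t in J) (H (s, t) `^ p)%:E)%E.
    rewrite [in RHS]integral_mkcond -ge0_integralZl_EFin ?powR_ge0//; last 2 first.
    - by move=> t _; apply: erestrict_ge0 => ? _; rewrite lee_fin powR_ge0.
    - apply/(measurable_restrictT _ _).1 => //; apply: measurable_funTS.
      apply/measurable_EFinP; apply: (measurableT_comp (measurable_powR _)).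
      exact: measurable_fun_pair2.
    apply: eq_integral => t _; rewrite patchE /Q /= !indicE sI mulr1.
    by case: ifPn => _; rewrite ?mulr1 ?mulr0 ?mule0// EFinM muleC.
  apply: le_trans (lee_wpmul2l _ (HJ s Is)) _; first by rewrite lee_fin powR_ge0.
  rewrite -!EFinM lee_fin powRM//; last by rewrite ltW// w0.
  by rewrite mulrCA -powRD subrK ?oner_eq0// powRr1// ltW// w0.
rewrite ge0_integralZl_EFin ?powR_ge0//; last 2 first.
- by move=> s Is; rewrite lee_fin ltW// w0.
- by apply/measurable_EFinP; exact: measurable_funTS.
apply: (@le_trans _ _ ((W `^ (p - 1))%:E * ((K `^ p)%:E * W%:E))%E).
  by rewrite !lee_wpmul2l ?lee_fin ?powR_ge0.
rewrite -!EFinM lee_fin powRM// mulrCA ler_wpM2l ?powR_ge0//.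
by rewrite mulrC mulr_powRB1.
Qed.

Lemma is_derive_powR_onem (a x : R) : x < 1 ->
  is_derive x 1 (fun s => (1 - s) `^ a) (- (a * (1 - x) `^ (a - 1))).
Proof.
move=> x1; have x1' : 1 - x \in `]0, +oo[ by rewrite in_itv/= andbT subr_gt0.
have h1 : is_derive (1 - x) 1 (@powR R ^~ a) (a * (1 - x) `^ (a - 1)).
  apply: DeriveDef; first exact: derivable_powR.
  by rewrite -derive1E powR_derive1.
have h2 : is_derive x 1 (fun s : R => 1 - s) (- 1).
  by rewrite -[X in is_derive _ _ _ X]sub0r; exact: is_deriveB.
have := @is_derive1_comp _ (@powR R ^~ a) (fun s : R => 1 - s) x _ _ h1 h2.
by rewrite mulrN1.
Qed.

(** For a < 1 the weight blows up at 1: the antiderivative -(1 - s)^a / a is used on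
    [r, 1 - 1/(n + 1)], and monotone convergence gives the bound on [r, 1). *)
Lemma integral_powR_onem_le (a r : R) : 0 < a -> r < 1 ->
  (\int[mu]_(s in `[r, 1%R[) ((1 - s) `^ (a - 1))%:E <= ((1 - r) `^ a / a)%:E)%E.
Proof.
move=> a0 r1.
have mw : measurable_fun [set: R] (fun s : R => (1 - s) `^ (a - 1)).
  by apply: (measurableT_comp (measurable_powR _)); exact: measurable_funB.
have w0 s : (0 <= ((1 - s) `^ (a - 1))%:E :> \bar R)%E by rewrite lee_fin powR_ge0.
pose S (n : nat) := `[r, 1 - n.+1%:R^-1]%classic : set R.
have -> : `[r, 1%R[%classic = \bigcup_n S n.
  apply/seteqP; split => [s|s [n _]]; rewrite /S /= !in_itv/= => /andP[h1 h2].
    have s1 : 0 < 1 - s by rewrite subr_gt0.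
    exists (Num.truncn (1 - s)^-1) => //; rewrite /S /= in_itv/= h1/=.
    rewrite lerBrDr addrC -lerBrDr invf_ple ?posrE//.
    by apply: ltW; exact: truncnS_gt.
  by rewrite h1/=; apply: le_lt_trans h2 _; rewrite gtrBl invr_gt0.
have ndS : nondecreasing_seq S.
  move=> i j ij; apply/subsetPset => s; rewrite /S /= !in_itv/= => /andP[-> h].
  by apply: le_trans h _; rewrite lerD2l lerN2 lef_pV2 ?posrE// ler_nat.
have mS i : measurable (S i : set (measurableTypeR R)) by exact: measurable_itv.
have H : (\int[mu]_(s in S i) ((1 - s) `^ (a - 1))%:E)%E @[i --> \oo] -->
    (\int[mu]_(s in \bigcup_i S i) ((1 - s) `^ (a - 1))%:E)%E.
  apply: ge0_nondecreasing_set_cvg_integral => //.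
  by move=> i; apply: measurable_funTS; exact/measurable_EFinP.
rewrite -(cvg_lim _ H)//; apply: lime_le; first exact: cvgP H.
apply: nearW => n; rewrite /S; set b := 1 - _.
have b1 : b < 1 by rewrite gtrBl invr_gt0.
have R0 : 0 <= (1 - r) `^ a / a by rewrite divr_ge0 ?powR_ge0// ltW.
have [rb|br|rb] := ltgtP r b; last 2 first.
- by rewrite set_itv_ge ?integral_set0 ?lee_fin// bnd_simp -ltNge.
- by rewrite -rb set_itv1 integral_set1 lee_fin.
have dF (x : R) : x < 1 -> is_derive x 1 (fun s => - (a^-1 * (1 - s) `^ a)) ((1 - x) `^ (a - 1)).
  move=> x1; have h := is_derive_powR_onem a x1.
  have -> : (1 - x) `^ (a - 1) = - (a^-1 * - (a * (1 - x) `^ (a - 1))).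
    by field; rewrite gt_eqF.
  apply: is_deriveN; exact: is_deriveZ.
rewrite (@continuous_FTC2 _ _ (fun s => - (a^-1 * (1 - s) `^ a)))//.
- rewrite -EFinB lee_fin opprK addrC mulrC gerDl oppr_le0.
  by rewrite mulr_ge0 ?invr_ge0 ?powR_ge0// ltW.
- apply: continuous_at_within => x /=; rewrite in_itv/= => /andP[_ xb].
  have x1 : x < 1 by lra.
  have [h _] := is_derive_powR_onem (a - 1) x1.
  exact/differentiable_continuous/derivable1_diffP.
- have cF (x : R) : x < 1 -> {for x, continuous (fun s : R => - (a^-1 * (1 - s) `^ a) : R)}.
    by move=> x1; have [h _] := dF x x1; exact/differentiable_continuous/derivable1_diffP.
  split.
  + by move=> x; rewrite in_itv/= => /andP[_ xb]; have [] := dF x _ => //; lra.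
  + by apply: cvg_at_right_filter; apply: cF; lra.
  + by apply: cvg_at_left_filter; apply: cF; lra.
- move=> x; rewrite in_itv/= => /andP[_ xb]; have x1 : x < 1 by lra.
  by rewrite derive1E (@derive_val _ _ _ _ _ _ _ (dF x x1)).
Qed.
End MeasureTools.

(** * Radial behaviour of an analytic map *)

Lemma continuous_at_comp (T U V : topologicalType) (g : T -> U) (h : U -> V) (x : T) :
  {for x, continuous g} -> {for g x, continuous h} ->
  {for x, continuous (fun y => h (g y))}.
Proof. by move=> cg ch; exact: (cvg_comp g h cg ch). Qed.

Section Polar.
Context {R : realType}.
Implicit Types (r s t : R).

Lemma normc_polar r t : modulus (polar r t) = `|r|.
Proof.
by rewrite /polar /= !exprMn -mulrDr cos2Dsin2 mulr1 sqrtr_sqr.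
Qed.

Lemma unit_disk_polar r t : unit_disk (polar r t) = (`|r| < 1).
Proof. by rewrite -(normc_polar r t). Qed.

Lemma polarD2pi r t : polar r (t + 2 * pi) = polar r t.
Proof.
have -> : t + 2 * pi = t + pi + pi by ring.
by rewrite /polar !cosDpi !sinDpi !opprK.
Qed.

Lemma continuous_polar (x : R * R) :
  {for x, continuous (fun x : R * R => polar x.1 x.2)}.
Proof.
have h1 : {for x, continuous (fun x : R * R => x.1)} by exact: cvg_fst.
have h2 : {for x, continuous (fun x : R * R => x.2)} by exact: cvg_snd.
apply: cvg_ReIm; apply: cvgM => //.
  by apply: (continuous_comp h2); exact: continuous_cos.
by apply: (continuous_comp h2); exact: continuous_sin.
Qed.

Lemma cderiv_polar_radius r t : cderiv (fun s => polar s t) r (polar 1 t).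
Proof.
move=> e e0; apply: (@nearW _ (nbhs (0 : R))) => h.
have -> : polar (h + r) t - polar r t - h%:C%C * polar 1 t = 0.
  by rewrite /polar; simpc; apply/eqP; rewrite eq_complex /=; apply/andP; split; apply/eqP; ring.
by rewrite Normc.normc0 mulr_ge0// ltW.
Qed.

(** Multiplication by i is written as a rotation by pi/2, so the derivative is again a [polar]
    value, whose modulus is |r| by [normc_polar]. *)
Lemma cderiv_polar_angle r t : cderiv (polar r) t (polar r (t + pi / 2)).
Proof.
apply/cderivP; rewrite /polar /= cosDpihalf sinDpihalf.
have hc := is_derive_cos t; have hs := is_derive_sin t.
by split; exact: is_deriveZ.
Qed.

Lemma continuous_polar_angle r t : {for t, continuous (polar r)}.
Proof. exact: cderiv_continuous (cderiv_polar_angle r t). Qed.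

Lemma continuous_mulC (T : topologicalType) (x : T) (u v : T -> R[i]) :
  {for x, continuous u} -> {for x, continuous v} ->
  {for x, continuous (fun y => u y * v y)}.
Proof.
by move=> cu cv; exact: (@cvgM R[i] T (nbhs x) (nbhs_filter x) u v _ _ cu cv).
Qed.
End Polar.

(** * Powers of sums and one-sided limits *)

Section Powers.
Context {R : realType}.
Local Open Scope ereal_scope.
Implicit Types (x y z : \bar R) (p : R).

Lemma le_poweR p x y : (0 <= p)%R -> 0 <= x -> x <= y -> x `^ p <= y `^ p.
Proof.
move=> p0 x0 xy; apply: gt0_ler_poweR => //; rewrite in_itv/= leey andbT//.
exact: le_trans xy.
Qed.

(** The sum is at most three times its largest term. *)
Lemma poweRD3_le p x y z : (0 <= p)%R -> 0 <= x -> 0 <= y -> 0 <= z ->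
  (x + y + z) `^ p <= (3 `^ p)%:E * (x `^ p + y `^ p + z `^ p).
Proof.
move=> p0 x0 y0 z0.
have [u [u0 [xu yu zu] up]] : exists u, [/\ 0 <= u, [/\ x <= u, y <= u & z <= u] &
    u `^ p <= x `^ p + y `^ p + z `^ p].
  have h1 : 0 <= x `^ p by exact: poweR_ge0.
  have h2 : 0 <= y `^ p by exact: poweR_ge0.
  have h3 : 0 <= z `^ p by exact: poweR_ge0.
  have [xy|/ltW yx] := leP x y.
    have [yz|/ltW zy] := leP y z.
      exists z; split => //; first by split => //; exact: le_trans yz.
      by rewrite leeDr// adde_ge0.
    exists y; split => //; apply: le_trans (leeDl _ h3).
    by rewrite leeDr.
  have [xz|/ltW zx] := leP x z.
    exists z; split => //; first by split => //; exact: le_trans xz.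
    by rewrite leeDr// adde_ge0.
  by exists x; split => //; rewrite -addeA leeDl// adde_ge0.
apply: (@le_trans _ _ ((3%:E * u) `^ p)).
  apply: le_poweR; rewrite ?adde_ge0//.
  have -> : 3%:E * u = u + u + u.
    have -> : 3%:E = (1 + 1 + 1)%:E :> \bar R by congr EFin; lra.
    by rewrite !EFinD !ge0_muleDl ?mul1e ?adde_ge0 ?lee_fin.
  by rewrite !leeD.
by rewrite poweRM// poweR_EFin lee_wpmul2l// lee_fin powR_ge0.
Qed.
End Powers.

Section LeftLimits.
Context {R : realType}.

(** A Jordan decomposition: [phi] dominates the increments of [v], so [phi] and [v + phi] are both
    nondecreasing, and both are bounded near 1. *)
Lemma cvg_left_bounded_variation (v phi : R -> R) (B : R) :
  (forall r r', 0 < r -> r < r' -> r' < 1 -> `|v r' - v r| <= phi r' - phi r) ->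
  (forall r, 0 < r -> r < 1 -> phi r <= B) -> cvg (v r @[r --> 1^'-]).
Proof.
move=> vphi phiB.
have gt_half : \forall x \near (1 : R)^'-, 1/2 < x by apply: nbhs_left_gt; lra.
have nd (w : R -> R) (C : R) :
    (forall r r', 0 < r -> r < r' -> r' < 1 -> w r <= w r') ->
    (forall r, 1/2 < r -> r < 1 -> w r <= C) -> cvg (w r @[r --> 1^'-]).
  move=> wnd wC; apply: nondecreasing_at_left_is_cvgr; apply: filterS gt_half => x x0.
    move=> r r'; rewrite !in_itv/= => /andP[xr r1] /andP[xr' r'1].
    rewrite le_eqVlt => /predU1P[->//|rr'].
    by apply: wnd => //; lra.
  exists C => y [r /=]; rewrite in_itv/= => /andP[xr r1] <-.
  by apply: wC => //; exact: lt_trans xr.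
have cphi : cvg (phi r @[r --> 1^'-]).
  apply: (nd _ B) => [r r' r0 rr' r'1|r r0 r1]; last by apply: phiB; lra.
  have := vphi r r' r0 rr' r'1; have := normr_ge0 (v r' - v r); lra.
have cs : cvg (v r + phi r @[r --> 1^'-]).
  (* From the base point 1/2 one has v(r) <= v(1/2) + phi(r) - phi(1/2), and phi(r) <= B is used
     twice. *)
  apply: (nd _ (v (1/2) + 2 * B - phi (1/2))) => [r r' r0 rr' r'1|r r0 r1].
    by have := vphi r r' r0 rr' r'1; rewrite ler_norml => /andP[]; lra.
  have half : 0 < (1/2 : R) by lra.
  have := vphi (1/2) r half r0 r1; rewrite ler_norml => /andP[_].
  have rpos : 0 < r by lra.
  have := phiB r rpos r1; lra.
have -> : v = (fun r => (v r + phi r) - phi r) by apply/funext => r; rewrite addrK.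
by apply: is_cvgB.
Qed.
End LeftLimits.

(** * Lengths of images of radii and arcs *)

Section Disc.
Context {R : realType} (D : set R[i]) (rho : R[i] -> R) (f df : R[i] -> R[i]).
Local Notation mu := (@lebesgue_measure R).
Context (oD : open D) (rho0 : forall z, D z -> 0 < rho z)
  (crho : {within D, continuous rho}) (fD : forall z, unit_disk z -> D (f z))
  (fdf : forall z, unit_disk z -> strict_deriv f z (df z)).
Implicit Types (z : R[i]) (s r t : R).

Lemma strict_deriv_continuous_at z L : strict_deriv f z L -> {for z, continuous f}.
Proof.
move=> H; apply/cvg_at_normcCP => e e0; have [d d0 Hd] := H _ ltr01.
have K0 : 0 < 1 + modulus L by rewrite ltr_pwDl ?normc_ge0.
exists (Num.min d (e / (1 + modulus L))).
  by rewrite lt_min d0 divr_gt0.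
move=> w; rewrite lt_min ltr_pdivlMr// => /andP[wd we].
have := Hd z w; rewrite subrr Normc.normc0 normcB => /(_ d0).
rewrite (normcB (f z - f w)) => H1.
have {}H1 := H1 wd.
have -> : f z - f w = - (L * (z - w) - (f z - f w)) + L * (z - w) by ring.
apply: le_lt_trans (normcD _ _) _; rewrite normcN Normc.normcM.
apply: le_lt_trans we; lra.
Qed.

Lemma unit_disk_nbhs z : unit_disk z -> nbhs z (@unit_disk R).
Proof.
move=> z1; apply/nbhs_normcP; exists (1 - modulus z); first by rewrite subr_gt0.
move=> w; rewrite normcB => zw; have := normcD (w - z) z; rewrite subrK /unit_disk /=; lra.
Qed.

(** For [w] near [z], the derivatives at [z] and at [w] both approximate the same difference
    quotient, between [w] and an auxiliary point [y] close to it. *)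
Lemma df_continuous z : unit_disk z -> {for z, continuous df}.
Proof.
move=> z1; apply/cvg_at_normcCP => e e0.
have e2 : 0 < e / 4 by rewrite divr_gt0.
have [d d0 Hd] := fdf z1 e2.
have /nbhs_normcP[d1 d10 Hd1] := unit_disk_nbhs z1.
exists (Num.min d d1); first by rewrite lt_min d0.
move=> w; rewrite lt_min => /andP[wd wd1].
have [d2 d20 Hd2] := fdf (Hd1 w wd1) e2.
have wd' : 0 < d - modulus (z - w) by rewrite subr_gt0.
(* The step to [y] is small enough for the estimate at [w] (radius [d2]) and keeps [y] in the ball
   around [z] (radius [d]). *)
pose h : R := Num.min (d2 / 2) ((d - modulus (z - w)) / 2).
have h0 : 0 < h by rewrite lt_min !divr_gt0.
have hd2 : h < d2 by rewrite gt_min; apply/orP; left; lra.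
have hd : h < d - modulus (z - w) by rewrite gt_min; apply/orP; right; lra.
pose y := w + h%:C%C.
have yw : modulus (y - w) = h.
  by rewrite /y addrC addKr /= expr0n/= addr0 sqrtr_sqr gtr0_norm.
have h1 := Hd2 y w; rewrite yw subrr Normc.normc0 in h1.
have {}h1 := h1 hd2 d20.
have h2 := Hd y w; rewrite yw (normcB w) in h2.
have yz : modulus (y - z) < d.
  have -> : y - z = (y - w) + (w - z) by ring.
  by apply: le_lt_trans (normcD _ _) _; rewrite yw (normcB w); lra.
have {}h2 := h2 yz wd.
have : modulus ((df z - df w) * (y - w)) <= e / 2 * h.
  have -> : (df z - df w) * (y - w) =
    (f y - f w - df w * (y - w)) + - (f y - f w - df z * (y - w)) by ring.
  by apply: le_trans (normcD _ _) _; rewrite normcN; lra.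
by rewrite Normc.normcM yw ler_pM2r//; lra.
Qed.

(** The closed formula for the rho-derivative; [rho_deriv_strict] identifies the two. *)
Definition fstar z := rho (f z) * modulus (df z).

Lemma f_continuous z : unit_disk z -> {for z, continuous f}.
Proof. by move=> z1; exact: strict_deriv_continuous_at (fdf z1). Qed.

Lemma fstar_continuous z : unit_disk z -> {for z, continuous fstar}.
Proof.
move=> z1.
have crf : {for f z, continuous rho}.
  by move: crho; rewrite continuous_open_subspace// => /(_ (f z)); apply; rewrite inE; exact: fD.
have h1 : rho (f w) @[w --> z] --> rho (f z) by exact: cvg_comp (f_continuous z1) crf.
have h2 : modulus (df w) @[w --> z] --> modulus (df z).
  by apply: cvg_comp (df_continuous z1) _; exact: continuous_normc.
exact: (@cvgM _ R[i] (nbhs z) (nbhs_filter z) _ _ _ _ h1 h2).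
Qed.

(** The value 0 for |s| >= 1 makes this a nonnegative measurable function on the whole plane, the
    setting of Tonelli's theorem. *)
Definition fpolar (x : R * R) := if `|x.1| < 1 then fstar (polar x.1 x.2) else 0.

Lemma fpolar_ge0 x : 0 <= fpolar x.
Proof.
rewrite /fpolar; case: ifPn => // x1; rewrite mulr_ge0 ?normc_ge0// ltW// rho0//.
by apply: fD; rewrite unit_disk_polar.
Qed.

Lemma fpolarE s t : `|s| < 1 -> fpolar (s, t) = fstar (polar s t).
Proof. by move=> s1; rewrite /fpolar /= s1. Qed.

Lemma fpolarD2pi s t : fpolar (s, t + 2 * pi) = fpolar (s, t).
Proof. by rewrite /fpolar /= polarD2pi. Qed.

Lemma fstar_polar_continuous (x : R * R) : `|x.1| < 1 ->
  {for x, continuous (fun x : R * R => fstar (polar x.1 x.2))}.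
Proof.
move=> x1; apply: (continuous_at_comp (@continuous_polar R x)).
by apply: fstar_continuous; rewrite unit_disk_polar.
Qed.

Lemma open_strip : open [set x : R * R | `|x.1| < 1].
Proof.
apply: (@open_comp _ _ (fun x : R * R => `|x.1|) [set y : R | y < 1]); last exact: open_lt.
move=> x _; apply: (cvg_comp (fun x : R * R => x.1) (fun y : R => `|y|)); first exact: cvg_fst.
exact: norm_continuous.
Qed.

Lemma measurable_fpolar : measurable_fun [set: R * R] fpolar.
Proof.
have -> : fpolar = (fun x : R * R => fstar (polar x.1 x.2)) \_ [set x : R * R | `|x.1| < 1].
  apply/funext => x; rewrite patchE /fpolar.
  by case: ifPn => [x1|x1]; [rewrite mem_set|rewrite memNset//; exact/negP].
have mA := open_measurable_prod open_strip.
apply/(measurable_restrictT _ mA).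
apply: continuous_measurable_prod open_strip _ => x; exact: fstar_polar_continuous.
Qed.

Lemma cderiv_f g t l : unit_disk (g t) -> cderiv g t l ->
  cderiv (fun u => f (g u)) t (df (g t) * l).
Proof. by move=> g1; apply: cderiv_strict; exact: fdf. Qed.

Lemma C1_curve_comp (a b : R) g dg : (forall t, a <= t <= b -> unit_disk (g t)) ->
  C1_curve a b g dg -> C1_curve a b (fun t => f (g t)) (fun t => df (g t) * dg t).
Proof.
move=> g1 gC t tab; have [gt dgt] := gC t tab.
split; first by apply: cderiv_f => //; exact: g1.
have h : {for t, continuous (fun u => df (g u))}.
  apply: (continuous_at_comp (cderiv_continuous gt)); apply: df_continuous; exact: g1.
exact: (continuous_mulC h dgt).
Qed.

Lemma C1_curve_radius r r' t :
  C1_curve r r' (fun s => polar s t) (fun=> polar 1 t).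
Proof. by move=> s _; split; [exact: cderiv_polar_radius|exact: cvg_cst]. Qed.

Lemma C1_curve_angle r a b : C1_curve a b (polar r) (fun t => polar r (t + pi / 2)).
Proof.
move=> t _; split; first exact: cderiv_polar_angle.
apply: (@continuous_at_comp _ _ _ (fun t => t + pi / 2) (polar r)); last exact: continuous_polar_angle.
by apply: cvgD; [exact: cvg_id|exact: cvg_cst].
Qed.

Lemma fpolar_integrand_ge0 s t : (0 <= (fpolar (s, t))%:E)%E.
Proof. by rewrite lee_fin fpolar_ge0. Qed.

Lemma radius_integrand r r' t : 0 <= r -> r' < 1 ->
  (\int[mu]_(s in `[r, r']) (rho (f (polar s t)) * modulus (df (polar s t) * polar 1 t))%:E =
   \int[mu]_(s in `[r, r']) (fpolar (s, t))%:E)%E.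
Proof.
move=> r0 r'1; apply: eq_integral => s; rewrite inE /= in_itv/= => /andP[rs sr'].
rewrite fpolarE; last by rewrite ger0_norm; lra.
by rewrite Normc.normcM normc_polar normr1 mulr1.
Qed.

Lemma rho_dist_radius r r' t z : 0 <= r -> r < r' -> r' < 1 ->
  (rho_dist D rho (f (polar r t)) z <=
   \int[mu]_(s in `[r, r']) (fpolar (s, t))%:E + rho_dist D rho (f (polar r' t)) z)%E.
Proof.
move=> r0 rr' r'1; rewrite -radius_integrand//.
have s1 s : r <= s <= r' -> unit_disk (polar s t).
  by move=> /andP[rs sr']; rewrite unit_disk_polar ger0_norm; lra.
have C0 : C1_curve r r' (fun s => polar s t) (fun=> polar 1 t).
  exact: C1_curve_radius.
have C := C1_curve_comp s1 C0.
exact: (rho_dist_prepend z rho0 rr' C (fun s sr => fD (s1 s sr))).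
Qed.

Lemma rho_dist_radius_rev r r' t z : 0 <= r -> r < r' -> r' < 1 ->
  (rho_dist D rho (f (polar r' t)) z <=
   \int[mu]_(s in `[r, r']) (fpolar (s, t))%:E + rho_dist D rho (f (polar r t)) z)%E.
Proof.
move=> r0 rr' r'1; rewrite -radius_integrand//.
have s1 s : r <= s <= r' -> unit_disk (polar s t).
  by move=> /andP[rs sr']; rewrite unit_disk_polar ger0_norm; lra.
have C0 : C1_curve r r' (fun s => polar s t) (fun=> polar 1 t).
  exact: C1_curve_radius.
have C := C1_curve_comp s1 C0.
exact: (rho_dist_prepend_rev z rho0 rr' C (fun s sr => fD (s1 s sr))).
Qed.

Lemma rho_dist_angle_rev r t t' z : 0 <= r -> r < 1 -> t < t' ->
  (rho_dist D rho (f (polar r t')) z <=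
   \int[mu]_(u in `[t, t']) (fpolar (r, u))%:E + rho_dist D rho (f (polar r t)) z)%E.
Proof.
move=> r0 r1 tt'.
have u1 u : t <= u <= t' -> unit_disk (polar r u).
  by move=> _; rewrite unit_disk_polar ger0_norm.
apply: (@le_trans _ _ (\int[mu]_(u in `[t, t'])
    (rho (f (polar r u)) * modulus (df (polar r u) * polar r (u + pi / 2)))%:E +
    rho_dist D rho (f (polar r t)) z)%E).
  have C0 : C1_curve t t' (polar r) (fun u => polar r (u + pi / 2)).
    exact: C1_curve_angle.
  have C := C1_curve_comp u1 C0.
  exact: (rho_dist_prepend_rev z rho0 tt' C (fun s sr => fD (u1 s sr))).
apply: leeD2r; apply: ge0_le_integral_nonmeas => u; rewrite /= in_itv/= => /u1 d1.
  by apply: (@integrand_ge0 _ D rho _ _ rho0); exact: fD.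
rewrite fpolarE ?ger0_norm// lee_fin Normc.normcM normc_polar ger0_norm// mulrA.
(* The speed [r] of the arc is bounded by 1. *)
by rewrite ler_piMr ?(ltW r1)// mulr_ge0 ?normc_ge0// ltW// rho0//; exact: fD.
Qed.

(** Serves the radii away from 1, about which the growth hypothesis is silent: a smaller closed disk
    is compact. *)
Lemma fpolar_bounded r : r < 1 -> exists2 M, 0 <= M &
  forall s t, 0 <= s <= r -> - pi <= t <= pi -> fpolar (s, t) <= M.
Proof.
move=> r1; pose A := (`[0%R, r]%classic `*` `[(- pi)%R, pi]%classic) : set (R * R).
have cA : compact A by apply: compact_setX; exact: segment_compact.
have cF : {within A, continuous (fun x : R * R => fstar (polar x.1 x.2))}.
  apply: continuous_at_within => x [/=]; rewrite !in_itv/= => /andP[h1 h2] _.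
  by apply: fstar_polar_continuous; rewrite ger0_norm//; lra.
have [M [Mr HM]] := compact_bounded (continuous_compact cF cA).
exists (`|M| + 1); first by rewrite addr_ge0.
move=> s t sr tp; rewrite fpolarE; last by case/andP: sr => s0 sr; rewrite ger0_norm//; lra.
have Mlt : M < `|M| + 1 by rewrite (le_lt_trans (ler_norm _))// ltrDl.
apply: le_trans (ler_norm _) _; apply: (HM _ Mlt).
by exists (s, t) => //; split; rewrite /= in_itv.
Qed.

Lemma ae_imply2 (P Q S : R -> Prop) : (forall t, P t -> Q t -> S t) ->
  {ae mu, forall t, P t} -> {ae mu, forall t, Q t} -> {ae mu, forall t, S t}.
Proof.
move=> PQS aeP aeQ.
apply: (negligibleS _ (negligibleU aeP aeQ)) => t nS.
have [Pt|nP] := pselect (P t); last by left.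
by right => Qt; apply: nS; exact: PQS.
Qed.

Lemma ae_imply1 (P S : R -> Prop) : (forall t, P t -> S t) ->
  {ae mu, forall t, P t} -> {ae mu, forall t, S t}.
Proof. by move=> PS aeP; apply: (ae_imply2 _ aeP aeP) => t /PS. Qed.

(** * Boundary values along radii of finite rho-length *)

Context (m : R) (m0 : 0 < m) (mrho : forall y, D y -> m <= rho y).

Lemma rho_dist_ge_normc z w : ((m * modulus (w - z))%:E <= rho_dist D rho z w)%E.
Proof.
have := @rho_dist_ge _ D rho z w m m (modulus (w - z)) (ltW m0) (ltW m0) mrho.
by rewrite minxx; apply => y Dy _; exact: mrho.
Qed.

(** For 0 <= r < 1, the rho-length of the image of the radius at angle [t], from modulus [r] out to
    the circle. *)
Definition tail r t := (\int[mu]_(s in `[r, 1%R[) (fpolar (s, t))%:E)%E.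

Lemma tail_ge0 r t : (0 <= tail r t)%E.
Proof. by apply: integral_ge0 => s _; exact: fpolar_integrand_ge0. Qed.

Lemma measurable_tail r : measurable_fun [set: R] (tail r).
Proof.
pose Q (x : R * R) : \bar R := (fpolar x * \1_(`[r, 1%R[%classic) x.1)%:E.
have mQ : measurable_fun [set: R * R] Q.
  apply/measurable_EFinP; apply: measurable_funM; first exact: measurable_fpolar.
  by apply: measurableT_comp => //; exact: measurable_indic.
have -> : tail r = (fun t => \int[mu]_s Q (s, t))%E.
  apply/funext => t; rewrite /tail integral_mkcond; apply: eq_integral => s _.
  by rewrite patchE /Q /= indicE; case: ifPn => _; rewrite ?mulr1 ?mulr0.
apply: measurable_fun_fubini_tonelli_G => // x.
by rewrite lee_fin mulr_ge0// fpolar_ge0.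
Qed.

Lemma segment_le_tail r r' t : 0 <= r -> r' < 1 ->
  (\int[mu]_(s in `[r, r']) (fpolar (s, t))%:E <= tail r t)%E.
Proof.
move=> r0 r'1; apply: (ge0_subset_integral_nonmeas mu (measurable_itv _)
  (measurable_itv _) (fun s _ => fpolar_integrand_ge0 s t)).
by move=> s /=; rewrite !in_itv/= => /andP[-> /le_lt_trans]; apply.
Qed.

Lemma tail_le r t : 0 <= r -> (tail r t <= tail 0 t)%E.
Proof.
move=> r0; apply: (ge0_subset_integral_nonmeas mu (measurable_itv _)
  (measurable_itv _) (fun s _ => fpolar_integrand_ge0 s t)).
by move=> s /=; rewrite !in_itv/= => /andP[/(le_trans r0) -> ->].
Qed.

Lemma polar0 t : polar (0 : R) t = 0.
Proof. by rewrite /polar !mul0r. Qed.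

Lemma unit_disk0 : @unit_disk R 0.
Proof. by rewrite -(polar0 0) unit_disk_polar normr0. Qed.

Lemma rho_dist_center r t : 0 < r -> r < 1 ->
  (rho_dist D rho (f (polar r t)) (f 0%R) <= tail 0 t)%E.
Proof.
move=> r0 r1; apply: le_trans (@rho_dist_radius_rev 0 r t (f 0) (lexx _) r0 r1) _.
rewrite polar0 -[leRHS]adde0; apply: leeD; first exact: segment_le_tail.
by apply: rho_dist_refl_le; apply: fD; exact: unit_disk0.
Qed.

Lemma radial_limit_cvg t : (tail 0 t < +oo)%E ->
  exists l : R[i], f (polar r t) @[r --> 1^'-] --> l.
Proof.
move=> Gfin.
have I0 r r' : (0 <= \int[mu]_(s in `[r, r']) (fpolar (s, t))%:E)%E.
  by apply: integral_ge0 => s _; exact: fpolar_integrand_ge0.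
have Ifin r r' : 0 <= r -> r' < 1 ->
    (\int[mu]_(s in `[r, r']) (fpolar (s, t))%:E)%E \is a fin_num.
  move=> r0 r'1; rewrite ge0_fin_numE//.
  by apply: le_lt_trans (segment_le_tail _ r0 r'1) _; apply: le_lt_trans Gfin; exact: tail_le.
(* Length of the image up to modulus [r], divided by the lower bound [m] of rho: it dominates the
   Euclidean increments of [f], hence those of its real and imaginary parts. *)
pose phi r := fine (\int[mu]_(s in `[0%R, r]) (fpolar (s, t))%:E)%E / m.
have phiE r r' : 0 < r -> r < r' -> r' < 1 ->
    modulus (f (polar r' t) - f (polar r t)) <= phi r' - phi r.
  move=> r0 rr' r'1; rewrite /phi -mulrBl ler_pdivlMr// mulrC -lee_fin.
  apply: le_trans (rho_dist_ge_normc _ _) _.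
  apply: le_trans (@rho_dist_radius r r' t _ (ltW r0) rr' r'1) _.
  apply: (@le_trans _ _ (\int[mu]_(s in `[r, r']) (fpolar (s, t))%:E + 0)%E).
    rewrite leeD2l//; apply: rho_dist_refl_le; apply: fD.
    by rewrite unit_disk_polar ger0_norm; lra.
  have r1 : r < 1 by lra.
  have r'0 : 0 <= r' by lra.
  rewrite adde0 EFinB !fineK ?Ifin// leeBrDr ?Ifin// addeC.
  have -> : `[0%R, r']%classic = `[0%R, r]%classic `|` `]r, r']%classic.
    apply/seteqP; split => u /=; rewrite !in_itv/=.
      by move=> /andP[h1 h2]; have [tc|ct] := leP u r; [left|right]; apply/andP.
    by move=> [] /andP[h1 h2]; apply/andP; split; lra.
  apply: le_trans (ge0_integral_setU_ge mu (measurable_itv _) (measurable_itv _) _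
    (fun u _ => fpolar_integrand_ge0 u t)).
    rewrite leeD2l// [leLHS]ge0_integral_itv_bndoo_nonmeas => [|u _]; last exact: fpolar_integrand_ge0.
    by rewrite [leRHS]ge0_integral_itv_bndoo_nonmeas => // u _; exact: fpolar_integrand_ge0.
  rewrite disj_set2E; apply/eqP; apply/seteqP; split => // u [] /=.
  rewrite !in_itv/=; lra.
have phiB r : 0 < r -> r < 1 -> phi r <= fine (tail 0 t) / m.
  move=> r0 r1; rewrite ler_pM2r ?invr_gt0//; apply: fine_le; first exact: Ifin.
    by rewrite ge0_fin_numE// tail_ge0.
  exact: segment_le_tail.
have cR : cvg (complex.Re (f (polar r t)) @[r --> 1^'-]).
  apply: (@cvg_left_bounded_variation _ _ phi (fine (tail 0 t) / m)) => // r r' r0 rr' r'1.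
  by apply: le_trans (phiE r r' r0 rr' r'1); rewrite -ReB normr_Re_le.
have cI : cvg (complex.Im (f (polar r t)) @[r --> 1^'-]).
  apply: (@cvg_left_bounded_variation _ _ phi (fine (tail 0 t) / m)) => // r r' r0 rr' r'1.
  by apply: le_trans (phiE r r' r0 rr' r'1); rewrite -ImB normr_Im_le.
move/cvg_ex : cR => [a ca]; move/cvg_ex : cI => [b cb].
by exists (Complex a b); apply: cvg_ReIm.
Qed.

Lemma radial_limitP t : (tail 0 t < +oo)%E ->
  f (polar r t) @[r --> 1^'-] --> radial_limit f t.
Proof. by move=> /radial_limit_cvg[l fl]; apply/cvg_ex; exists l. Qed.

Lemma radial_limitD2pi t : radial_limit f (t + 2 * pi) = radial_limit f t.
Proof.
rewrite /radial_limit; have -> // : (fun r => f (polar r (t + 2 * pi))) =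
  (fun r => f (polar r t)).
by apply/funext => r; rewrite polarD2pi.
Qed.

Context (hbdy : forall eta, D eta ->
  rho_dist D rho zeta eta @[zeta --> to_boundary D] --> +oo%E).

Lemma near_left_radius (P : R -> Prop) :
  (\forall r \near 1^'-, P r) -> forall r0 : R, r0 < 1 -> exists r, [/\ r0 < r, r < 1 & P r].
Proof.
move=> nP r0 r01.
have h1 : \forall r \near (1 : R)^'-, r0 < r by exact: nbhs_left_gt.
have h2 : \forall r \near (1 : R)^'-, r < 1 by exact: nbhs_left_lt.
have [r [? [? ?]]] := filter_ex (filterI h1 (filterI h2 nP)).
by exists r.
Qed.

Lemma radial_limit_in t : (tail 0 t < +oo)%E -> D (radial_limit f t).
Proof.
move=> Gfin; have fl := radial_limitP Gfin; set l := radial_limit f t in fl *.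
apply: contrapT => nDl.
have D0 : D (f 0) by apply: fD; exact: unit_disk0.
(* A limit of points of [D] lies in the closure; being outside [D], it is not interior. *)
have bl : extended_boundary D (Some l).
  split.
    move=> A /= Al; have Al' : nbhs l (fun z => A (Some z)) by exact: Al.
    have [r [r0 r1 Ar]] := near_left_radius (fl _ Al') ltr01.
    exists (Some (f (polar r t))); split => //=; exists (f (polar r t)) => //.
    by apply: fD; rewrite unit_disk_polar gtr0_norm.
  move=> /interior_subset[z Dz [zl]]; apply: nDl; by rewrite -zl.
(* Near the boundary the distance to [f 0] exceeds [tail 0 t], whereas [rho_dist_center] bounds it
   by [tail 0 t] along the radius. *)
have hA : to_boundary D (fun zeta => (tail 0 t < rho_dist D rho zeta (f 0%R))%E).
  have := hbdy D0; move=> /(_ (fun x => (tail 0 t < x)%E)); apply.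
  exists (fine (tail 0 t)); split; first exact: num_real.
  by rewrite fineK// ge0_fin_numE// tail_ge0.
have := hA _ bl => hl.
have {}hl : nbhs l (fun z => forall zeta, D zeta ->
    Some z = Some zeta :> one_point_compactification R[i] ->
    (tail 0 t < rho_dist D rho zeta (f 0%R))%E) by exact: hl.
have [r [r0 r1]] := near_left_radius (fl _ hl) ltr01.
move=> /(_ (f (polar r t)) _ erefl)/=; rewrite ltNge rho_dist_center//=.
by move=> H; suff : false by []; apply: H; apply: fD; rewrite unit_disk_polar gtr0_norm.
Qed.

(** The radius is followed only up to some r' < 1. The gap to the limit [l] is closed by a segment
    in a ball where rho <= rho(l) + 1, at a cost below any given [e]. *)
Lemma rho_dist_limit_radius t r z : (tail 0 t < +oo)%E -> 0 < r -> r < 1 ->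
  (rho_dist D rho (radial_limit f t) z <= tail r t + rho_dist D rho (f (polar r t)) z)%E /\
  (rho_dist D rho (f (polar r t)) z <= tail r t + rho_dist D rho (radial_limit f t) z)%E.
Proof.
move=> Gfin r0 r1; have fl := radial_limitP Gfin.
have Dl := radial_limit_in Gfin; set l := radial_limit f t in fl Dl *.
have [d d0 Hd] := metric_near oD crho Dl ltr01.
have M0 : 0 < rho l + 1 by rewrite ltr_wpDl// ltW// rho0.
have dM u : modulus (u - l) < d -> D u /\ rho u <= rho l + 1.
  by move=> /Hd[Du]; rewrite ltr_norml => /andP[h1 h2]; split => //; lra.
have step (e : R) : 0 < e -> exists r', [/\ r < r', r' < 1,
    modulus (f (polar r' t) - l) < d & (rho l + 1) * modulus (f (polar r' t) - l) <= e].
  move=> e0.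
  have e1 : 0 < Num.min d (e / (rho l + 1)) by rewrite lt_min d0 divr_gt0.
  have [r' [rr' r'1]] := near_left_radius ((cvg_normcP _ _ _).1 fl _ e1) r1.
  rewrite lt_min normcB ltr_pdivlMr// mulrC => /andP[h1 /ltW h2].
  by exists r'.
split; apply/lee_addgt0Pr => e /step[r' [rr' r'1 fd fe]].
- apply: le_trans (@rho_dist_prepend_segment _ D rho l l (f (polar r' t)) z d _ rho0 dM _ fd) _.
    by rewrite subrr Normc.normc0.
  rewrite [leRHS]addeC; apply: leeD; first by rewrite lee_fin.
  apply: le_trans (@rho_dist_radius_rev r r' t z (ltW r0) rr' r'1) _.
  by rewrite leeD2r//; exact: (segment_le_tail _ (ltW r0) r'1).
- apply: le_trans (@rho_dist_radius r r' t z (ltW r0) rr' r'1) _.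
  rewrite -[leRHS]addeA; apply: leeD; first exact: (segment_le_tail _ (ltW r0) r'1).
  rewrite addeC.
  apply: le_trans (@rho_dist_prepend_segment _ D rho l (f (polar r' t)) l z d _ rho0 dM fd _) _.
    by rewrite subrr Normc.normc0.
  by rewrite leeD2r// lee_fin normcB.
Qed.

(** For 0 <= r < 1, an upper bound for the rho-length of the image of the arc from angle [t] to
    [t + h]. The angle is shifted so that the interval of integration does not depend on [t], as in
    [integral_minkowski_weight]. *)
Definition arc r h t := (\int[mu]_(s in `[0%R, h]) (fpolar (r, (t + s)%R))%:E)%E.

Lemma rho_dist_radial_limit t h : 0 < h -> h < 1 ->
  (tail 0 t < +oo)%E -> (tail 0 (t + h)%R < +oo)%E ->
  (rho_dist D rho (radial_limit f (t + h)) (radial_limit f t) <=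
   tail (1 - h) (t + h)%R + arc (1 - h) h t + tail (1 - h) t)%E.
Proof.
move=> h0 h1 Gt Gth; have r0 : 0 < 1 - h by lra.
have r1 : 1 - h < 1 by lra.
apply: le_trans (rho_dist_limit_radius (radial_limit f t) Gth r0 r1).1 _.
rewrite -[leRHS]addeA leeD2l//.
have tth : t < t + h by rewrite ltrDl.
apply: le_trans (@rho_dist_angle_rev (1 - h) t (t + h) _ (ltW r0) r1 tth) _.
apply: leeD.
  have mF : measurable_fun [set: R] (fun u => (fpolar (1 - h, u))%:E).
    by apply/measurable_EFinP; exact: measurable_fun_pair2 measurable_fpolar.
  have := @ge0_integral_itv_shift R 0 h t (fun u => (fpolar (1 - h, u))%:E)
    (measurable_funTS mF) (fun y _ => fpolar_integrand_ge0 _ y).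
  rewrite add0r (addrC h) => <-; rewrite le_eqVlt; apply/orP; left; apply/eqP.
  by apply: eq_integral => s _; rewrite (addrC s).
apply: le_trans (rho_dist_limit_radius (radial_limit f t) Gt r0 r1).2 _.
rewrite -[leRHS]adde0 leeD2l//; apply: rho_dist_refl_le; exact: radial_limit_in.
Qed.

(** * L^p bounds for tails and arcs, and the resulting memberships *)

Context (p alpha K : R) (p1 : 1 <= p) (alpha0 : 0 < alpha) (K0 : 0 <= K).
Context (mean_le : forall s, 0 <= s -> s < 1 ->
  (\int[mu]_(t in `[(- pi)%R, pi]) (fpolar (s, t) `^ p)%:E <=
   ((K * (1 - s) `^ (alpha - 1)) `^ p)%:E)%E).

Lemma p_gt0 : 0 < p.
Proof. exact: lt_le_trans p1. Qed.

(** The growth hypothesis uses the window [-pi, pi], the class of boundary functions uses [0, 2 pi],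
    and shifting the angle moves the window again; periodicity covers all of them. *)
Lemma window_mean_le s c : 0 <= s -> s < 1 ->
  (\int[mu]_(t in `[c, (c + 2 * pi)%R]) (fpolar (s, t) `^ p)%:E <=
   ((K * (1 - s) `^ (alpha - 1)) `^ p)%:E)%E.
Proof.
move=> s0 s1; apply: le_trans (mean_le s0 s1).
have mF : measurable_fun [set: R] (fun t => (fpolar (s, t) `^ p)%:E).
  apply/measurable_EFinP; apply: (measurableT_comp (measurable_powR _)).
  exact: measurable_fun_pair2 measurable_fpolar.
have pi2 : 0 < 2 * pi :> R by rewrite mulr_gt0// pi_gt0.
have F0 x : (0 <= (fpolar (s, x) `^ p)%:E)%E by rewrite lee_fin powR_ge0.
have FP x : ((fpolar (s, x + 2 * pi) `^ p)%:E = (fpolar (s, x) `^ p)%:E :> \bar R)%E.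
  by rewrite fpolarD2pi.
have := ge0_integral_periodic_le c (- pi) pi2 mF F0 FP.
by have -> : - pi + 2 * pi = pi :> R by lra.
Qed.

Lemma measurable_weight : measurable_fun [set: R] (fun s : R => (1 - s) `^ (alpha - 1)).
Proof. by apply: (measurableT_comp (measurable_powR _)); exact: measurable_funB. Qed.

Lemma window_tail_le r c : 0 <= r -> r < 1 ->
  (\int[mu]_(t in `[c, (c + 2 * pi)%R]) (tail r t) `^ p <=
   ((K * ((1 - r) `^ alpha / alpha)) `^ p)%:E)%E.
Proof.
move=> r0 r1; apply: (integral_minkowski_weight p1 (measurable_itv `[r, 1%R[)
  (measurable_itv `[c, (c + 2 * pi)]) measurable_fpolar measurable_weight) => //.
- exact: fpolar_ge0.
- by move=> s /=; rewrite in_itv/= => /andP[_ s1]; rewrite powR_gt0// subr_gt0.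
- by rewrite divr_ge0 ?powR_ge0// ltW.
- exact: integral_powR_onem_le.
- move=> s /=; rewrite in_itv/= => /andP[rs s1]; apply: window_mean_le => //.
  exact: le_trans rs.
Qed.

(** On the circle of radius 1 - h the mean is at most K h^(alpha - 1) for every shift [s] of the
    angle, so the weight is constant, with mass h^alpha on [0, h]. *)
Lemma arc_le h : 0 < h -> h < 1 ->
  (\int[mu]_(t in `[0%R, (2 * pi)%R]) (arc (1 - h) h t) `^ p <=
   ((K * h `^ alpha) `^ p)%:E)%E.
Proof.
move=> h0 h1.
pose H (x : R * R) := fpolar (1 - h, x.2 + x.1).
have mH : measurable_fun [set: R * R] H.
  apply: (measurableT_comp measurable_fpolar); apply/measurable_fun_pair => //=.
  exact: measurable_funD.
have -> : h `^ alpha = h `^ (alpha - 1) * h.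
  rewrite -[X in _ * X]powRr1 ?(ltW h0)// -powRD ?subrK//.
  by rewrite (gt_eqF h0) implybT.
apply: (@integral_minkowski_weight R H (fun=> h `^ (alpha - 1)) `[0%R, h] `[0%R, (2 * pi)%R]) => //.
- by move=> x; exact: fpolar_ge0.
- by move=> s _; exact: powR_gt0.
- by rewrite mulr_ge0 ?powR_ge0// ltW.
- by rewrite integral_cst//= lebesgue_measure_itv/= lte_fin h0 oppr0 adde0 EFinM.
move=> s /=; rewrite in_itv/= => /andP[s0 sh].
have h'0 : 0 <= 1 - h by lra.
have h'1 : 1 - h < 1 by lra.
apply: le_trans; last by have := window_mean_le s h'0 h'1; rewrite subKr; apply.
have mF : measurable_fun [set: R] (fun t => (fpolar (1 - h, t) `^ p)%:E).
  apply/measurable_EFinP; apply: (measurableT_comp (measurable_powR _)).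
  exact: measurable_fun_pair2 measurable_fpolar.
have := @ge0_integral_itv_shift R 0 (2 * pi) s (fun t => (fpolar (1 - h, t) `^ p)%:E)
  (measurable_funTS mF).
by rewrite add0r (addrC (2 * pi)) => -> // y _; rewrite lee_fin powR_ge0.
Qed.

Lemma ae_tail_fin : {ae mu, forall t, (tail 0 t < +oo)%E}.
Proof.
(* Countably many windows of length 2 pi cover the line, indexed by coded integers; a code of no
   integer gives 0, which merely repeats a window. *)
pose c (n : nat) : R := if (unpickle n : option int) is Some k then k%:~R * (2 * pi) else 0.
have H n : {ae mu, forall t, `[c n, (c n + 2 * pi)%R]%classic t -> (tail 0 t < +oo)%E}.
  have mp : measurable_fun [set: R] (fun t => (tail 0 t `^ p)%E).
    by apply: (measurableT_comp (measurable_poweR _)); exact: measurable_tail.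
  have : mu.-integrable `[c n, (c n + 2 * pi)%R] (fun t => (tail 0 t `^ p)%E).
    apply/integrableP; split; first exact: measurable_funTS.
    under eq_integral do rewrite gee0_abs ?poweR_ge0//.
    by apply: le_lt_trans (@window_tail_le 0 (c n) (lexx _) ltr01) _; rewrite ltry.
  move=> itg.
  have : {ae mu, forall t, `[c n, (c n + 2 * pi)%R]%classic t -> (tail 0 t `^ p)%E \is a fin_num}.
    by apply: integrable_ae itg; exact: measurable_itv.
  apply: ae_imply1 => t ht /ht tfin.
  by apply: (@lty_poweRy _ _ p); [rewrite gt_eqF// p_gt0|rewrite ltey_eq tfin].
have /ae_foralln : forall n, {ae mu, forall t, `[c n, (c n + 2 * pi)%R]%classic t -> (tail 0 t < +oo)%E}.
  exact: H.
apply: ae_imply1 => t.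
have pi0 : 0 < 2 * pi :> R by rewrite mulr_gt0// pi_gt0.
pose k := Num.floor (t / (2 * pi)).
move=> /(_ (pickle k)); apply; rewrite /c pickleK /= in_itv/=.
have := real_floor_itv (num_real (t / (2 * pi))); rewrite -/k => /andP[k1 k2].
rewrite -ler_pdivlMr// k1/= -[X in _ <= _ + X]mul1r -mulrDl -ler_pdivrMr//.
by rewrite ltW//; move: k2; rewrite intrD mulr1z.
Qed.

Lemma ae_shift (P : R -> Prop) (h : R) : {ae mu, forall t, P t} ->
  {ae mu, forall t, P (t + h)}.
Proof.
move=> [N [mN N0 PN]]; exists ((fun x => x + h) @^-1` N); split.
- by rewrite -[X in measurable X]setTI; exact: (measurable_fun_shift h).
- by rewrite -N0 -(lebesgue_measure_shift h mN).
- by move=> t Pt; apply: PN.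
Qed.

Lemma rho_Hp_of_mean : analytic_mapping D f -> rho_Hp D rho p f.
Proof.
move=> hf; split => //.
apply: (@le_lt_trans _ _ ((K * (1 / alpha))%:E)); last exact: ltry.
apply: ge_ereal_sup => y [r /=]; rewrite in_itv/= => /andP[r0 r1] <-.
have p0 := p_gt0.
have KA : 0 <= K * (1 / alpha) by rewrite mulr_ge0// divr_ge0// ltW.
have -> : (K * (1 / alpha))%:E = (((K * (1 / alpha)) `^ p)%:E `^ p^-1)%E.
  by rewrite poweR_EFin -powRrM mulfV ?gt_eqF// powRr1.
apply: le_poweR; rewrite ?invr_ge0 ?(ltW p0)//.
  by apply: integral_ge0 => t _; exact: poweR_ge0.
apply: (@le_trans _ _ (\int[mu]_(t in `[(- pi)%R, pi]) (tail 0 t) `^ p)%E).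
  apply: ge0_le_integral_nonmeas => t _; first exact: poweR_ge0.
  by apply: le_poweR; rewrite ?(ltW p0) ?rho_dist_ge0// rho_dist_center.
have := @window_tail_le 0 (- pi) (lexx _) ltr01.
have -> : - pi + 2 * pi = pi :> R by lra.
by rewrite subr0 powR1.
Qed.

Lemma measurable_arc h : measurable_fun [set: R] (arc (1 - h) h).
Proof.
pose Q (x : R * R) : \bar R := (fpolar (1 - h, x.2 + x.1) * \1_(`[0%R, h]%classic) x.1)%:E.
have mQ : measurable_fun [set: R * R] Q.
  apply/measurable_EFinP; apply: measurable_funM; last first.
    by apply: measurableT_comp => //; exact: measurable_indic.
  apply: (measurableT_comp measurable_fpolar); apply/measurable_fun_pair => //=.
  exact: measurable_funD.
have -> : arc (1 - h) h = (fun t => \int[mu]_s Q (s, t))%E.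
  apply/funext => t; rewrite /arc integral_mkcond; apply: eq_integral => s _.
  by rewrite patchE /Q /= indicE; case: ifPn => _; rewrite ?mulr1 ?mulr0.
apply: measurable_fun_fubini_tonelli_G => // x.
by rewrite lee_fin mulr_ge0// fpolar_ge0.
Qed.

Lemma arc_ge0 r h t : (0 <= arc r h t)%E.
Proof. by apply: integral_ge0 => s _; exact: fpolar_integrand_ge0. Qed.

(** With B = K h^alpha / alpha, each of the three pieces has p-th power integral at most B^p. Then
    [poweRD3_le] gives 3^p times 3 B^p, and 3 <= 3^p turns this into (9 B)^p. *)
Lemma radial_limit_modulus h : alpha <= 1 -> 0 < h -> h < 1 ->
  (poweR (\int[mu]_(t in `[0%R, (2 * pi)%R])
     poweR (rho_dist D rho (radial_limit f (t + h)%R) (radial_limit f t)) p) (p^-1)%R <=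
   (9 * K / alpha * h `^ alpha)%:E)%E.
Proof.
move=> alpha1 h0 h1.
have p0 := p_gt0.
have ha := powR_ge0 h alpha.
pose B := K * (h `^ alpha / alpha).
have B0 : 0 <= B by rewrite mulr_ge0// divr_ge0// ltW.
have KB : 0 <= 9 * K / alpha * h `^ alpha by rewrite mulr_ge0// divr_ge0 ?mulr_ge0// ltW.
have -> : (9 * K / alpha * h `^ alpha)%:E =
    (((9 * K / alpha * h `^ alpha) `^ p)%:E `^ p^-1)%E.
  by rewrite poweR_EFin -powRrM mulfV ?gt_eqF// powRr1.
apply: le_poweR; rewrite ?invr_ge0 ?(ltW p0)//.
  by apply: integral_ge0 => t _; exact: poweR_ge0.
have r0 : 0 <= 1 - h by lra.
have r1 : 1 - h < 1 by lra.
pose T1 t := (tail (1 - h) (t + h)%R `^ p)%E.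
pose T2 t := (arc (1 - h) h t `^ p)%E.
pose T3 t := (tail (1 - h) t `^ p)%E.
have mtail := measurable_tail (1 - h).
have mT3 : measurable_fun [set: R] T3 by exact: (measurableT_comp (measurable_poweR _)).
have mT1 : measurable_fun [set: R] T1.
  by apply: (measurableT_comp mT3); exact: measurable_fun_shift.
have mT2 : measurable_fun [set: R] T2.
  by apply: (measurableT_comp (measurable_poweR _)); exact: measurable_arc.
have T10 t : (0 <= T1 t)%E by exact: poweR_ge0.
have T20 t : (0 <= T2 t)%E by exact: poweR_ge0.
have T30 t : (0 <= T3 t)%E by exact: poweR_ge0.
apply: (@le_trans _ _ (\int[mu]_(t in `[0%R, (2 * pi)%R])
    ((3 `^ p)%:E * (T1 t + T2 t + T3 t)))%E).
  apply: ge0_ae_le_integral_nonmeas => //.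
  - by move=> t _; exact: poweR_ge0.
  - apply: measurable_funeM; apply: emeasurable_funD => //; exact: emeasurable_funD.
  - by move=> t; rewrite mule_ge0 ?lee_fin ?powR_ge0// !adde_ge0.
  (* Both radii, at [t] and at [t + h], must have images of finite length. *)
  apply: ae_imply2 ae_tail_fin (ae_shift h ae_tail_fin) => t Gt Gth _.
  apply: le_trans (poweRD3_le (ltW p0) (tail_ge0 _ _) (arc_ge0 _ _ _) (tail_ge0 _ _)).
  apply: le_poweR; rewrite ?(ltW p0) ?rho_dist_ge0//.
  exact: rho_dist_radial_limit.
rewrite ge0_integralZl_EFin ?powR_ge0//; last 2 first.
- by move=> t _; rewrite !adde_ge0.
- by apply: measurable_funTS; apply: emeasurable_funD => //; exact: emeasurable_funD.
rewrite ge0_integralD//; [|by move=> t _; rewrite adde_ge0|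
  by apply: measurable_funTS; exact: emeasurable_funD|exact: measurable_funTS].
rewrite ge0_integralD//; [|exact: measurable_funTS|exact: measurable_funTS].
have b1 : (\int[mu]_(t in `[0%R, (2 * pi)%R]) T1 t <= (B `^ p)%:E)%E.
  have := @ge0_integral_itv_shift R 0 (2 * pi) h T3 (measurable_funTS mT3) (fun y _ => T30 y).
  rewrite add0r (addrC (2 * pi)) => ->.
  by have := @window_tail_le (1 - h) h r0 r1; rewrite subKr.
(* Here alpha <= 1 enters: h^alpha <= h^alpha / alpha. *)
have b2 : (\int[mu]_(t in `[0%R, (2 * pi)%R]) T2 t <= (B `^ p)%:E)%E.
  apply: le_trans (arc_le h0 h1) _; rewrite lee_fin; apply: ge0_ler_powR.
  - exact: ltW.
  - by rewrite nnegrE mulr_ge0.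
  - by rewrite nnegrE.
  by rewrite /B ler_wpM2l// ler_pdivlMr// ler_piMr.
have b3 : (\int[mu]_(t in `[0%R, (2 * pi)%R]) T3 t <= (B `^ p)%:E)%E.
  by have := @window_tail_le (1 - h) 0 r0 r1; rewrite subKr add0r.
apply: (@le_trans _ _ ((3 `^ p)%:E * ((B `^ p)%:E + (B `^ p)%:E + (B `^ p)%:E))%E).
  apply: lee_wpmul2l; first by rewrite lee_fin powR_ge0.
  exact: leeD (leeD b1 b2) b3.
rewrite -!EFinD -EFinM lee_fin.
have -> : 9 * K / alpha * h `^ alpha = 3 * (3 * B) by rewrite /B; field; rewrite gt_eqF.
have B3 : 0 <= 3 * B by rewrite mulr_ge0.
have -> : (3 * (3 * B)) `^ p = 3 `^ p * (3 `^ p * B `^ p).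
  by rewrite (powRM _ (ler0n _ 3) B3) (powRM _ (ler0n _ 3) B0).
apply: ler_wpM2l; first exact: powR_ge0.
have -> : B `^ p + B `^ p + B `^ p = 3 * B `^ p by ring.
apply: ler_wpM2r; first exact: powR_ge0.
by apply: le1r_powR => //; lra.
Qed.

(** On the measurable set [E] of finite tails the boundary function is a pointwise limit of the
    continuous functions t -> f(r_n e^(it)); off [E], a null set, the value 0 is used. *)
Lemma radial_limit_measurable : lebesgue_measurable (radial_limit f).
Proof.
pose E := [set t | tail 0 t \is a fin_num].
have mE : measurable (E : set (measurableTypeR R)).
  by rewrite -[E]setTI; apply: emeasurable_fin_num => //; exact: measurable_tail.
have EP t : E t <-> (tail 0 t < +oo)%E by rewrite /E /= ge0_fin_numE// tail_ge0.
(* The shifted index starts the sequence at 1/2, so that every radius is positive. *)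
pose r n : R := 1 - harmonic n.+1.
have r1 n : r n < 1 by rewrite gtrBl harmonic_gt0.
have r0 n : 0 < r n by rewrite subr_gt0 invf_lt1// ltr1n.
have rcvg : r @ \oo --> (1 : R).
  rewrite -[X in _ --> X]subr0; apply: cvgB; first exact: cvg_cst.
  by rewrite (cvg_shiftS (@harmonic R)); exact: cvg_harmonic.
have part (q : R[i] -> R) : continuous q ->
    measurable_fun [set: R] (fun t => if t \in E then q (radial_limit f t) else 0).
  move=> cq; pose h n t := if t \in E then q (f (polar (r n) t)) else 0.
  apply: (@measurable_fun_cvg _ _ _ _ h) => [n|t _].
    have mq : measurable_fun [set: R] (fun t => q (f (polar (r n) t))).
      apply: continuous_measurable_fun => t.
      apply: (@continuous_at_comp _ _ _ (fun t => f (polar (r n) t)) q); last exact: cq.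
      apply: continuous_at_comp; first exact: continuous_polar_angle.
      by apply: f_continuous; rewrite unit_disk_polar gtr0_norm.
    apply: measurable_fun_ifT => //.
    by apply: (measurable_fun_bool true) => /=; rewrite setTI preimage_mem_true.
  rewrite /h; case: ifPn => tE; last exact: cvg_cst.
  have /EP tfin := set_mem tE.
  suff fr : f (polar (r n) t) @[n --> \oo] --> radial_limit f t.
    exact: cvg_comp fr (cq _).
  apply/cvg_normcP => e e0.
  have H := (cvg_normcP _ _ _).1 (radial_limitP tfin) e e0.
  have : nbhs (1 : R) (fun s => s < 1 -> modulus (radial_limit f t - f (polar s t)) < e).
    exact: H.
  move=> /rcvg [N _ HN]; exists N => // n Nn; exact: (HN n Nn (r1 n)).
exists (fun t => if t \in E then complex.Re (radial_limit f t) else 0).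
exists (fun t => if t \in E then complex.Im (radial_limit f t) else 0).
split; [exact: part continuous_Re|exact: part continuous_Im|].
apply: ae_imply1 ae_tail_fin => t /EP tE.
by rewrite mem_set//; case: (radial_limit f t).
Qed.

Lemma rho_Lambda_of_mean : alpha <= 1 -> rho_Lambda D rho p alpha (radial_limit f).
Proof.
move=> alpha1; split.
- exact: radial_limitD2pi.
- exact: radial_limit_measurable.
- by apply: ae_imply1 ae_tail_fin => t; exact: radial_limit_in.
exists (9 * K / alpha); apply: (@filterS2 _ _ _ (fun h => 0 < h) (fun h => h < 1)).
- move=> h h0 h1; rewrite (ger0_norm (powR_ge0 _ _)).
  have c0 : 0 <= 9 * K / alpha by rewrite divr_ge0 ?mulr_ge0// ltW.
  have H s : s \in `]0, h[ -> (poweR (\int[mu]_(t in `[0%R, (2 * pi)%R])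
     poweR (rho_dist D rho (radial_limit f (t + s)%R) (radial_limit f t)) p) (p^-1)%R <=
     (9 * K / alpha * h `^ alpha)%:E)%E.
    rewrite in_itv/= => /andP[s0 sh].
    apply: le_trans (radial_limit_modulus alpha1 s0 (lt_trans sh h1)) _.
    rewrite lee_fin ler_wpM2l//; apply: ge0_ler_powR; rewrite ?nnegrE ?ltW//.
  rewrite gee0_abs; first by apply: ge_ereal_sup => _ [s sh <-]; exact: H.
  (* The supremum is nonnegative because s = h / 2 contributes a nonnegative term. *)
  apply: ereal_sup_ge; eexists; first by exists (h / 2) => //; rewrite /= in_itv/=; lra.
  exact: poweR_ge0.
- exact: nbhs_right_gt.
- exact: nbhs_right_lt.
Qed.
End Disc.

(** * From growth near the circle to a bound at every radius *)

Section MeanBound.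
Context {R : realType} (D : set R[i]) (rho : R[i] -> R) (f df : R[i] -> R[i]).
Local Notation mu := (@lebesgue_measure R).
Context (oD : open D) (hrho : is_metric D rho) (fD : forall z, unit_disk z -> D (f z))
  (fdf : forall z, unit_disk z -> strict_deriv f z (df z)).
Context (m : R) (m0 : 0 < m) (mrho : forall y, D y -> m <= rho y).

Lemma int_mean_rho_deriv p s : 0 <= s -> s < 1 ->
  int_mean p s (rho_deriv D rho f) =
  ((\int[mu]_(t in `[(- pi)%R, pi]) (fpolar rho f df (s, t) `^ p)%:E) `^ p^-1)%E.
Proof.
move=> s0 s1; rewrite /int_mean; congr poweR; apply: eq_integral => t _.
have d1 : unit_disk (polar s t) by rewrite unit_disk_polar ger0_norm.
rewrite (rho_deriv_strict oD hrho m0 mrho (fD d1) (fdf d1)).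
by rewrite -poweR_EFin fpolarE// ger0_norm.
Qed.

(** Up to the radius [r] the means are bounded by compactness, and since alpha <= 1 the weight is at
    least 1 there, so enlarging the constant suffices. *)
Lemma mean_bound (p alpha : R) : 1 <= p -> alpha <= 1 ->
  big_O 1^'- (fun r => int_mean p r (rho_deriv D rho f)) (fun r => (1 - r) `^ (alpha - 1)) ->
  exists2 K, 0 <= K & forall s, 0 <= s -> s < 1 ->
    (\int[mu]_(t in `[(- pi)%R, pi]) (fpolar rho f df (s, t) `^ p)%:E <=
     ((K * (1 - s) `^ (alpha - 1)) `^ p)%:E)%E.
Proof.
move=> p1 alpha1 [K1 HK1].
have p0 : 0 < p by exact: lt_le_trans p1.
have rho0 := hrho.1.
have [d d0 Hd] : exists2 d : R, 0 < d & forall s, 1 - d < s -> s < 1 ->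
    (`|int_mean p s (rho_deriv D rho f)| <= (K1 * `|(1 - s) `^ (alpha - 1)|)%:E)%E.
  move: HK1; rewrite near_withinE => /nbhs_normP[d /= d0 Hd].
  exists d => // s ds s1; apply: (Hd s) => //=.
  by rewrite gtr0_norm ?subr_gt0//; lra.
pose r := Num.max 0 (1 - d / 2).
have r1 : r < 1 by rewrite gt_max ltr01/=; lra.
have rd : 1 - d < r by rewrite lt_max; apply/orP; right; lra.
have [M M0 HM] := fpolar_bounded oD hrho.2 fD fdf r1.
have pi0 : 0 <= 2 * pi :> R by rewrite mulr_ge0// pi_ge0.
(* The L^p norm over [-pi, pi] of the constant [M]. *)
pose c := (2 * pi) `^ p^-1 * M.
have c0 : 0 <= c by rewrite mulr_ge0// powR_ge0.
exists (`|K1| + c); first by rewrite addr_ge0.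
move=> s s0 s1; set X := integral _ _ _.
have X0 : (0 <= X)%E by apply: integral_ge0 => t _; rewrite lee_fin powR_ge0.
have w0 : 0 <= (1 - s) `^ (alpha - 1) by exact: powR_ge0.
have [sr|rs] := leP s r.
  apply: (@le_trans _ _ (\int[mu]_(t in `[(- pi)%R, pi]) (cst (M `^ p)%:E t))%E).
    apply: ge0_le_integral_nonmeas => t tpi; first by rewrite lee_fin powR_ge0.
    rewrite lee_fin; apply: ge0_ler_powR; rewrite ?nnegrE ?(ltW p0)//.
      exact: (fpolar_ge0 _ rho0 fD).
    by apply: HM; [rewrite s0|move: tpi; rewrite /= in_itv].
  have pipi : - pi < pi :> R by have := pi_gt0 R; lra.
  rewrite integral_cst//= lebesgue_measure_itv/= lte_fin pipi -EFinD -EFinM lee_fin.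
  have -> : M `^ p * (pi + - - pi) = c `^ p.
    rewrite /c powRM ?powR_ge0// -powRrM mulVf ?gt_eqF// powRr1//; lra.
  have Kc : 0 <= `|K1| + c by rewrite addr_ge0.
  apply: ge0_ler_powR; [exact: ltW|exact: c0|by rewrite nnegrE mulr_ge0|].
  apply: (@le_trans _ _ ((`|K1| + c) * 1)); first by rewrite mulr1 lerDr.
  apply: ler_wpM2l => //.
  have h : 0 < 1 - s <= 1 by lra.
  have a1 : alpha - 1 <= 0 by lra.
  by have := @ger_powR _ _ h (alpha - 1) 0; rewrite powRr0 => /(_ a1).
have ds : 1 - d < s by exact: lt_trans rs.
have := Hd s ds s1; rewrite int_mean_rho_deriv// -/X gee0_abs ?poweR_ge0// => XK.
have -> : X = ((X `^ p^-1) `^ p)%E by rewrite -poweRrM mulVf ?gt_eqF// poweRe1.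
rewrite -poweR_EFin; apply: le_poweR; rewrite ?(ltW p0) ?poweR_ge0//.
apply: le_trans XK _; rewrite lee_fin (ger0_norm w0) ler_wpM2r//.
by rewrite (le_trans (ler_norm _))// lerDl.
Qed.
End MeanBound.

Theorem theorem4p2 (R : realType) (D : set R[i]) (rho : R[i] -> R)
    (alpha p : R) (f : R[i] -> R[i])
    (hD : domain D) (hrho : is_metric D rho)
    (hrho_inf : 0 < inf [set rho zeta | zeta in D])
    (hbdy : forall eta, D eta ->
       rho_dist D rho zeta eta @[zeta --> to_boundary D] --> +oo%E)
    (halpha : 0 < alpha <= 1) (hp : 1 <= p)
    (hf : analytic_mapping D f)
    (hmean : big_O 1^'- (fun r => int_mean p r (rho_deriv D rho f))
                        (fun r => (1 - r) `^ (alpha - 1))) :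
  rho_Hp D rho p f /\
  ({ae @lebesgue_measure R, forall t, radial_limit_exists f t} /\
   rho_Lambda D rho p alpha (radial_limit f)).
Proof.
have [_ oD _] := hD; have [rho0 crho] := hrho; have /andP[alpha0 alpha1] := halpha.
have fD z : unit_disk z -> D (f z) by move=> /hf[].
(* The derivative is chosen pointwise, with no regularity; its continuity on the disk comes from
   strictness, through [df_continuous]. *)
have /choice[df fdf] : forall z, exists L, unit_disk z -> strict_deriv f z L.
  move=> z; have [z1|nz1] := pselect (unit_disk z); last by exists 0.
  by have [L HL] := analytic_strict_deriv (hf z z1).2; exists L.
have mrho y : D y -> inf [set rho zeta | zeta in D] <= rho y.
  move=> Dy; apply: ge_inf; last by exists y.
  by exists 0 => _ [z Dz <-]; exact: ltW (rho0 z Dz).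
have [K K0 HK] := mean_bound oD hrho fD fdf hrho_inf mrho hp alpha1 hmean.
split; [|split].
- exact: (rho_Hp_of_mean oD rho0 crho fD fdf hp alpha0 K0 HK hf).
- apply: ae_imply1 (ae_tail_fin oD rho0 crho fD fdf hp alpha0 K0 HK) => t tfin.
  exact: (cvgP _ (radial_limitP rho0 fD fdf hrho_inf mrho tfin)).
- exact: (rho_Lambda_of_mean oD rho0 crho fD fdf hrho_inf mrho hbdy hp alpha0 K0 HK alpha1).
Qed.
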